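(* Let $\Lambda\subset\mathbb{R}^d$ be compact and measurable, let $n=|\Lambda|$, let $\gamma\in(0,1)$, and let $\lambda=(1-\gamma)2^{1-d}$. The mixing time of the single-center dynamics with fugacity $\lambda$ on $\Omega_\Lambda^\tau$ satisfies $$t_{\mathrm{mix}}(\varepsilon)\le\left\lceil\frac{4n\left(\log(2^{d+2}n)+\log(1/\varepsilon)\right)}{\gamma}\right\rceil$$ for all boundary conditions $\tau$ (and all $\varepsilon>0$).
   Context: Let $r=r_d>0$ be the radius for which a ball of radius $r$ in $\mathbb{R}^d$ has volume $1$; $B_\ell(x)$ is the open ball of radius $\ell$ about $x$, and $|A|$ is the Lebesgue measure of $A\subset\mathbb{R}^d$. Let $\Lambda_{\mathrm{Int}}=\{x\in\Lambda:\mathrm{dist}(x,\Lambda^c)\ge r\}$. A boundary condition is a set $\tau\subseteq\Lambda_{\mathrm{Int}}$ of forbidden locations for centers. $\Omega_\Lambda^\tau$ is the set of all finite point sets in $\Lambda_{\mathrm{Int}}\setminus\tau$ whose points are at pairwise distance at least $2r$. Single-center dynamics with fugacity $\lambda$: the Markov chain on $\Omega_\Lambda^\tau$ which, given $X_t$, forms $X_{t+1}$ as follows. (1) Pick $x\in\Lambda$ uniformly at random. (2) With probability $1/(1+\lambda)$, set $X_{t+1}=X_t\setminus B_r(x)$. (3) With probability $\lambda/(1+\lambda)$, let $X'=X_t\cup\{x\}$; set $X_{t+1}=X'$ if $X'\in\Omega_\Lambda^\tau$, and $X_{t+1}=X_t$ otherwise. Its unique stationary distribution is the hard sphere measure $\mu=\mu_\Lambda^\tau$,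 the law of a Poisson point process of intensity $\lambda$ on $\Lambda_{\mathrm{Int}}\setminus\tau$ conditioned on all points being at pairwise distance at least $2r$. The mixing time is $$t_{\mathrm{mix}}(\varepsilon)=\sup_{p^{(0)}}\min\{t:\|p^{(t)}-\mu\|_{TV}\le\varepsilon\},$$ where $\|\cdot\|_{TV}$ denotes total variation distance, the supremum is over all probability distributions $p^{(0)}$ on the state space, and $p^{(t)}$ is the distribution after $t$ steps of the chain started from $p^{(0)}$.
   Formalization: The right side is replaced by max(0, ⌈…⌉): when ε is large or n is tiny the ceiling can be negative while t_mix ≥ 0, so the literal bound fails; for n = 0, where the logarithm is undefined, the bound is read as 0. The boundary condition τ is taken to be measurable. *)

(* Defs.v *)
From HB Require Import structures.
From mathcomp Require Import all_boot all_order all_algebra finmap.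
From mathcomp Require Import all_classical all_reals all_analysis.
Import Order.TTheory GRing.Theory Num.Theory.
Import numFieldNormedType.Exports.

Set Implicit Arguments.
Unset Strict Implicit.
Unset Printing Implicit Defensive.

Local Open Scope classical_set_scope.
Local Open Scope ring_scope.

Definition rv_display : measure_display.
Proof. exact: default_measure_display. Qed.

(* The sigma-algebra generated by the coordinates, i.e. the Borel sets of R^d,
   set up as the library does for n.-tuple T. *)
Section rV_measurable.
Variables (R : realType) (d : nat).

Definition rv_coord (i : 'I_d) (v : 'rV[R]_d) : measurableTypeR R := v ord0 i.

Let G := \big[setU/set0]_(i < d)
  preimage_set_system setT (rv_coord i) measurable.

HB.instance Definition _ := @isMeasurable.Build rv_display 'rV[R]_d
  (g_sigma_preimage rv_coord) (@sigma_algebra0 _ setT G) (@sigma_algebraC _ G)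
  (@sigma_algebra_bigcup _ setT G).

Lemma measurable_rv_coord (i : 'I_d) : measurable_fun setT (rv_coord i).
Proof.
move=> _ Y mY; rewrite setTI; apply: sub_sigma_algebra => /=.
rewrite -bigcup_seq/=; exists i => /=; first by rewrite mem_index_enum.
by exists Y => //; rewrite setTI.
Qed.

Lemma measurable_fun_rv (dT : measure_display) (T : measurableType dT)
    (f : T -> 'rV[R]_d) :
  (forall i, measurable_fun setT (rv_coord i \o f)) -> measurable_fun setT f.
Proof.
move=> mf _ Y mY; rewrite setTI.
have := mY; apply: (smallest_sub (X := [set A | measurable (f @^-1` A)])).
  split=> /=.
  - by rewrite preimage_set0.
  - by move=> A mA; rewrite setTD preimage_setC; exact: measurableC.
  - by move=> F mF; rewrite preimage_bigcup; exact: bigcupT_measurable.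
move=> A; rewrite -bigcup_seq/= => -[i _ [B mB <-]].
by rewrite setTI -comp_preimage -[X in measurable X]setTI; exact: mf.
Qed.

End rV_measurable.

Section sigma_finite_bundle.
Context (dT : measure_display) (T : measurableType dT) (R : realType).
Variables (m : {measure set T -> \bar R}) (fm : sigma_finite setT m).

Let m' : set T -> \bar R := m.
HB.instance Definition _ := Measure.on m'.
HB.instance Definition _ := Measure_isSigmaFinite.Build _ _ _ m' fm.

Lemma sigma_finite_bundle :
  exists m1 : {sigma_finite_measure set T -> \bar R},
    m1 = m :> (set T -> \bar R).
Proof. by exists m'. Qed.

End sigma_finite_bundle.

Section lebesgue_rV.
Context {R : realType}.

Definition rv_cons n (p : measurableTypeR R * 'rV[R]_n) : 'rV[R]_n.+1 :=
  row_mx (const_mx p.1 : 'rV[R]_1) p.2.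

(* Lebesgue measure on R^d, as the d-fold product of the one on R. *)
Fixpoint lebesgue_rV (d : nat) : set 'rV[R]_d -> \bar R :=
  if d is n.+1 then
    pushforward (lebesgue_measure \x @lebesgue_rV n)%E (@rv_cons n)
  else \d_(0 : 'rV[R]_0).

Let rv_uncons n (v : 'rV[R]_n.+1) : measurableTypeR R * 'rV[R]_n :=
  (v ord0 ord0, \row_i v ord0 (lift ord0 i)).

Let rv_consE n p i : @rv_cons n p ord0 i =
  if unlift ord0 i is Some j then p.2 ord0 j else p.1.
Proof.
rewrite /rv_cons mxE; case: unliftP => [j|] ->.
  case: splitP => [k|k].
    by rewrite [k]ord1.
  by move=> /eqP; rewrite /= /bump /= eqSS => /eqP /val_inj ->.
case: splitP => [k _|k] //.
by rewrite mxE.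
Qed.

Let rv_consK n : cancel (@rv_cons n) (@rv_uncons n).
Proof.
move=> p; rewrite /rv_uncons rv_consE unlift_none [RHS]surjective_pairing.
by congr pair; apply/rowP => i; rewrite mxE rv_consE liftK.
Qed.

Let measurable_rv_cons n : measurable_fun setT (@rv_cons n).
Proof.
apply: measurable_fun_rv => i.
have -> : rv_coord i \o @rv_cons n =
  fun p => if unlift ord0 i is Some j then rv_coord j p.2 else p.1.
  by apply/funext => p /=; rewrite /rv_coord rv_consE; case: unlift.
case: unlift => [j|]; last exact: measurable_fst.
by apply: measurableT_comp; [exact: measurable_rv_coord|exact: measurable_snd].
Qed.

Let measurable_rv_uncons n : measurable_fun setT (@rv_uncons n).
Proof.
apply: measurable_fun_pair; first exact: (@measurable_rv_coord R n.+1 ord0).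
apply: measurable_fun_rv => i.
have -> : rv_coord i \o (fun v : 'rV[R]_n.+1 => \row_i v ord0 (lift ord0 i)) =
  rv_coord (lift ord0 i) by apply/funext => v; rewrite /rv_coord /= mxE.
exact: measurable_rv_coord.
Qed.

Let lebesgue_rV_ex d : exists m : {sigma_finite_measure set 'rV[R]_d -> \bar R},
  @lebesgue_rV d = m.
Proof.
elim: d => [|n [m Em]] /=; first by exists \d_(0 : 'rV[R]_0).
rewrite Em.
pose L : {sigma_finite_measure set (measurableTypeR R) -> \bar R} :=
  lebesgue_measure.
pose P : {measure set (measurableTypeR R * 'rV[R]_n)%type -> \bar R} :=
  (L \x m)%E.
have [Q QE] : exists Q : {measure set 'rV[R]_n.+1 -> \bar R},
    Q = pushforward P (@rv_cons n) :> (set _ -> \bar R).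
  unshelve eexists (pushforward P (@rv_cons n)) => //.
  exact: measurable_rv_cons.
have sQ : sigma_finite setT (pushforward P (@rv_cons n)).
  have /sigma_finiteP[F [FT ndF Ffin]] := sigma_finiteT L.
  have /sigma_finiteP[G [GT ndG Gfin]] := sigma_finiteT m.
  exists (fun k => @rv_uncons n @^-1` (F k `*` G k)).
    rewrite -preimage_bigcup; apply/seteqP; split => // v _ /=.
    have: setT (rv_uncons v).1 by [].
    have: setT (rv_uncons v).2 by [].
    rewrite FT GT => -[k _ Gk] [l _ Fl]; exists (maxn k l) => //; split.
      by move: Fl; exact/subsetPset/ndF/leq_maxr.
    by move: Gk; exact/subsetPset/ndG/leq_maxl.
  move=> k; have [mF Fk] := Ffin k; have [mG Gk] := Gfin k; split.
    rewrite -[X in measurable X]setTI; apply: measurable_rv_uncons => //.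
    exact: measurableX.
  rewrite /pushforward -comp_preimage.
  have -> : @rv_uncons n \o @rv_cons n = id.
    by apply/funext => p; exact: rv_consK.
  by rewrite [ltLHS]product_measure1E// lte_mul_pinfty// ge0_fin_numE.
rewrite -QE in sQ *.
by have [S <-] := sigma_finite_bundle sQ; exists S.
Qed.

Let lebesgue_rV0 d : @lebesgue_rV d set0 = 0%E.
Proof. by have [m ->] := lebesgue_rV_ex d. Qed.

Let lebesgue_rV_ge0 d A : (0 <= @lebesgue_rV d A)%E.
Proof. by have [m ->] := lebesgue_rV_ex d. Qed.

Let lebesgue_rV_sigma_additive d : semi_sigma_additive (@lebesgue_rV d).
Proof.
have [m ->] := lebesgue_rV_ex d.
exact: (@measure_semi_sigma_additive _ _ _ m).
Qed.

HB.instance Definition _ d := isMeasure.Build _ _ _ (@lebesgue_rV d)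
  (@lebesgue_rV0 d) (@lebesgue_rV_ge0 d) (@lebesgue_rV_sigma_additive d).

Let lebesgue_rV_sigma_finite d : sigma_finite setT (@lebesgue_rV d).
Proof. by have [m ->] := lebesgue_rV_ex d; exact: (sigma_finiteT m). Qed.

HB.instance Definition _ d := Measure_isSigmaFinite.Build _ _ _ (@lebesgue_rV d)
  (@lebesgue_rV_sigma_finite d).

End lebesgue_rV.

Section euclidean.
Context {R : realType} {d : nat}.
Implicit Types (x y : 'rV[R]_d) (A : set 'rV[R]_d).

(* The library's norm on 'rV[R]_d is the sup norm. *)
Definition edist x y : R := Num.sqrt (\sum_(i < d) (x ord0 i - y ord0 i) ^+ 2).

Definition eball x (l : R) : set 'rV[R]_d := [set y | edist x y < l].

Definition edist_set x A : \bar R := ereal_inf [set (edist x y)%:E | y in A].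

End euclidean.

Definition conf (R : realType) (d : nat) := {fset 'rV[R]_d}.

Definition conf_display : measure_display.
Proof. exact: default_measure_display. Qed.

Section configurations.
Context {R : realType} {d : nat}.

HB.instance Definition _ := Choice.on (conf R d).
HB.instance Definition _ := Pointed.on (conf R d).

Definition npoints (B : set 'rV[R]_d) (X : conf R d) : nat :=
  #|` [fset x in X | x \in B]%fset |.

(* The usual sigma-algebra on point configurations, generated by the counts
   in Borel sets. *)
Let G : set (set (conf R d)) :=
  [set [set X | npoints Bk.1 X = Bk.2] | Bk in
    [set Bk : set 'rV[R]_d * nat | measurable Bk.1]].

HB.instance Definition _ := @isMeasurable.Build conf_display (conf R d)
  <<s G >> (@sigma_algebra0 _ setT G) (@sigma_algebraC _ G)
  (@sigma_algebra_bigcup _ setT G).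

End configurations.

Section hard_spheres.
Context {R : realType} {d : nat}.
Implicit Types (r lam : R) (Lam tau T : set 'rV[R]_d) (X : conf R d).

Definition interior_at r Lam : set 'rV[R]_d :=
  [set x | Lam x /\ (r%:E <= edist_set x (~` Lam))%E].

Definition hard_core r : set (conf R d) :=
  [set X | forall x y, x \in X -> y \in X -> x != y -> 2 * r <= edist x y].

Definition allowed r Lam tau : set 'rV[R]_d := interior_at r Lam `\` tau.

Definition Omega r Lam tau : set (conf R d) :=
  [set X | [set` X] `<=` allowed r Lam tau /\ hard_core r X].

(* Counts in Borel sets are Poisson, and counts in disjoint Borel sets are
   mutually independent. The library's poisson_pmf is not used because it is
   identically 1 at rate 0. *)
Definition is_poisson_process lam T (Pi : probability (conf R d) R) :=
  (forall (B : set 'rV[R]_d) (k : nat), measurable B ->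
    let m := lam * fine (lebesgue_rV (B `&` T)) in
    Pi [set X | npoints B X = k] = (expR (- m) * m ^+ k / k`!%:R)%:E) /\
  (forall (j : nat) (B : 'I_j -> set 'rV[R]_d) (k : 'I_j -> nat),
    (forall i, measurable (B i)) -> trivIset setT B ->
    Pi [set X | forall i, npoints (B i) X = k i] =
    \prod_(i < j) Pi [set X | npoints (B i) X = k i])%E.

Definition is_hard_sphere_measure r lam Lam tau (mu : probability (conf R d) R) :=
  exists2 Pi : probability (conf R d) R,
    is_poisson_process lam (allowed r Lam tau) Pi &
    forall A, measurable A ->
      mu A = (fine (Pi (A `&` hard_core r)) / fine (Pi (hard_core r)))%:E.

Definition uniform_on Lam (E : set 'rV[R]_d) : R :=
  fine (lebesgue_rV (E `&` Lam)) / fine (lebesgue_rV Lam).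

Definition remove_ball r X x : conf R d :=
  [fset y in X | y \notin eball x r]%fset.

Definition try_insert r Lam tau X x : conf R d :=
  let X' := (x |` X)%fset in if X' \in Omega r Lam tau then X' else X.

Definition single_center_kernel r lam Lam tau X (A : set (conf R d)) : \bar R :=
  ((1 + lam)^-1 * uniform_on Lam [set x | A (remove_ball r X x)] +
   lam / (1 + lam) * uniform_on Lam [set x | A (try_insert r Lam tau X x)])%:E.

End hard_spheres.

Section mixing.
Context {dT : measure_display} {T : measurableType dT} {R : realType}.
Implicit Types (p q : set T -> \bar R) (K : T -> set T -> \bar R) (S : set T).

Fixpoint law_after K p (t : nat) : set T -> \bar R :=
  if t is t'.+1 then fun A => (\int[law_after K p t']_x K x A)%E else p.

Definition tv_dist p q : \bar R :=
  ereal_sup [set `|p A - q A|%E | A in measurable].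

(* Distributions on the state space S are probability measures on the ambient
   type that give S mass 1. *)
Definition mixing_time K S (mu : probability T R) (eps : R) : \bar R :=
  ereal_sup [set
    ereal_inf [set t%:R%:E | t in
      [set t : nat | tv_dist (law_after K p t) mu <= eps%:E]%E]
    | p in [set p : probability T R | p S = 1%E]].

End mixing.

(* Main.v *)
(** Path coupling with a weighted metric, written for functions instead of
    couplings. The chain is first extended to all finite subsets X of the set T
    of allowed centers, overlaps included: deletions are unchanged, and x is
    inserted when x lies in F(X), the set of points of T at distance at least
    2r from X. Put M = 2^d, c = (1 - gam) / M (so that lam = 2 c), and give the
    pair (X, X + v) the weight
      w(X, v) = 1 + c u,   u = vol (F(X) & B_2r(v)) <= M,
    so 1 <= w <= 2. Let f satisfy |f (X + v) - f X| <= w(X, v) for all X and v,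
    and compare one step from X with one step from X + v, using the same random
    point and the same move.
    - A deletion at distance less than r from v makes the two chains meet.
      Another deletion can raise u, but a point y of B_2r(v) blocked by a center
      w of X becomes free only if the deletion point is in B_r(w): on average
      u increases by at most (M - u) / n.
    - An insertion at x in D = F(X) & B_2r(v) succeeds only from X. The path
      X + x, X + x + v, X + v then bounds the increment; it runs through an
      overlapping configuration, which is why the chain had to be extended.
    - An insertion at x in F(X + v) removes D & B_2r(x) from D. By Fubini this
      gain cancels the term vol (F(X + v) & B_2r(x)) of the weight of
      (X + v, x) in the previous case.
    The expected new weight is at most w - gam / (n (1 + lam)), hence at most
    (1 - gam / (4 n)) w. A packing of hard spheres has at most n centers, so
    iterating from the indicator of an event bounds the total variation
    distance to stationarity after t steps by 4 n (1 - gam / (4 n))^t.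

    That the hard sphere measure is stationary follows from Mecke's formula for
    the Poisson process, which in turn is checked on the pi-system of events
    that depend on finitely many counts in the cells of a finite partition. *)

From HB Require Import structures.
Require Import Defs.
From mathcomp Require Import all_boot all_order all_algebra finmap.
From mathcomp Require Import all_classical all_reals all_analysis.
From mathcomp Require Import measurable_realfun lra.
Import Order.TTheory GRing.Theory Num.Theory.
Import numFieldNormedType.Exports.
Import Defs.

Set Implicit Arguments.
Unset Strict Implicit.
Unset Printing Implicit Defensive.

Local Open Scope classical_set_scope.
Local Open Scope ring_scope.

(** * Lebesgue measure and Euclidean balls *)

Section affine_change_of_variables.
Context {R : realType}.

(** The pushforward of Lebesgue measure under x -> k x + a, scaled by k, is a measure with the right
    value on half-open intervals, and these determine Lebesgue measure. *)
Lemma lebesgue_measure_affine (k a : R) (A : set (measurableTypeR R)) :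
  0 < k -> measurable A ->
  (k%:E * lebesgue_measure ((fun x : R => k * x + a)%R @^-1` A) =
   lebesgue_measure A)%E.
Proof.
move=> k0 mA.
pose f : measurableTypeR R -> measurableTypeR R := fun x => k * x + a.
have mf : measurable_fun setT f.
  by apply: measurable_funD => //; apply: measurable_funM.
have k0' : 0 <= k by exact: ltW.
pose m : {measure set (measurableTypeR R) -> \bar R} :=
  mscale (NngNum k0') (pushforward lebesgue_measure f).
rewrite [RHS](@lebesgue_measure_unique _ (m mf))// => _ [[b c]] /= bc <-.
rewrite /m /= /mscale /= /pushforward /=.
have -> : f @^-1` `]b, c]%classic = `](b - a) / k, (c - a) / k]%classic.
  apply/seteqP; split => x; rewrite /f /= !in_itv/=.
    by rewrite ltr_pdivrMr// ler_pdivlMr// ltrBlDr lerBrDr mulrC.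
  by rewrite ltr_pdivrMr// ler_pdivlMr// ltrBlDr lerBrDr mulrC.
rewrite !lebesgue_measure_itv/= !lte_fin ltr_pM2r ?invr_gt0// ltrD2r.
case: ifPn => _; last by rewrite mule0.
rewrite -!EFinB -EFinM -mulrBl mulrCA divff ?gt_eqF// mulr1.
by congr EFin; lra.
Qed.

Lemma rv_coord_affine d (k : R) (v x : 'rV[R]_d) i :
  rv_coord i (k *: x + v) = k * rv_coord i x + rv_coord i v.
Proof. by rewrite /rv_coord !mxE. Qed.

Lemma measurable_affine d (k : R) (v : 'rV[R]_d) :
  measurable_fun setT (fun x : 'rV[R]_d => k *: x + v).
Proof.
apply: measurable_fun_rv => i.
rewrite (_ : _ \o _ = (fun x => k * rv_coord i x + rv_coord i v)).
  apply: measurable_funD => //; apply: measurable_funM => //.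
  exact: measurable_rv_coord.
by apply/funext => x /=; rewrite rv_coord_affine.
Qed.

Lemma rv_consE n (p : measurableTypeR R * 'rV[R]_n) i :
  rv_cons p ord0 i = if unlift ord0 i is Some j then p.2 ord0 j else p.1.
Proof.
rewrite /rv_cons mxE; case: unliftP => [j|] ->.
  case: splitP => [k|k]; first by rewrite [k]ord1.
  by move=> /eqP; rewrite /= /bump /= eqSS => /eqP /val_inj ->.
by case: splitP => [k _|k] //; rewrite mxE.
Qed.

Lemma measurable_rv_cons n : measurable_fun setT (@rv_cons R n).
Proof.
apply: measurable_fun_rv => i.
have -> : rv_coord i \o @rv_cons R n =
  fun p => if unlift ord0 i is Some j then rv_coord j p.2 else p.1.
  by apply/funext => p /=; rewrite /rv_coord rv_consE; case: unlift.
case: unlift => [j|]; last exact: measurable_fst.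
by apply: measurableT_comp; [exact: measurable_rv_coord|exact: measurable_snd].
Qed.

Lemma rv_cons_affine n (k a : R) (v x : 'rV[R]_n) (b : R) :
  k *: rv_cons (b, x) + rv_cons (a, v) = rv_cons (k * b + a, k *: x + v).
Proof.
apply/rowP => i; rewrite [LHS]mxE [X in X + _]mxE !rv_consE.
by case: unlift => [j|//]; rewrite !mxE.
Qed.

Lemma rv_cons_surj n (v : 'rV[R]_n.+1) : exists p, v = rv_cons p.
Proof.
exists (v ord0 ord0, \row_j v ord0 (lift ord0 j)).
by apply/rowP => i; rewrite rv_consE; case: unliftP => [j|] -> //=; rewrite mxE.
Qed.

(** Induction on the dimension. After splitting off the first coordinate both sides are measures on
    a product, so it suffices to compare them on rectangles, where the one-dimensional case and the
    induction hypothesis multiply. *)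
Lemma lebesgue_rV_affine d (k : R) (v : 'rV[R]_d) (A : set 'rV[R]_d) :
  0 < k -> measurable A ->
  ((k ^+ d)%:E * lebesgue_rV ((fun x => k *: x + v)%R @^-1` A) =
   lebesgue_rV A)%E.
Proof.
move=> k0; elim: d => [|d IH] in v A *.
  (* In dimension 0 the space is a single point, so the map is the identity. *)
  move=> mA; rewrite expr0 mul1e; congr lebesgue_rV.
  by apply/seteqP; split => x; rewrite /= (_ : _ + v = x)//; apply/rowP => -[].
move=> mA; have [[a w] ->] := rv_cons_surj v.
pose m1 : {sigma_finite_measure set (measurableTypeR R) -> \bar R} :=
  lebesgue_measure.
pose m2 : {sigma_finite_measure set 'rV[R]_d -> \bar R} := @lebesgue_rV R d.
pose f (p : measurableTypeR R * 'rV[R]_d) : measurableTypeR R * 'rV[R]_d :=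
  (k * p.1 + a, k *: p.2 + w).
have mf : measurable_fun setT f.
  apply: measurable_fun_pair.
    apply: measurable_funD => //; apply: measurable_funM => //.
  exact: (measurableT_comp (measurable_affine k w) measurable_snd).
have kn0 : 0 <= k ^+ d.+1 by rewrite exprn_ge0// ltW.
pose m : {measure set (measurableTypeR R * 'rV[R]_d)%type -> \bar R} :=
  mscale (NngNum kn0) (pushforward (m1 \x m2)%E f).
have mE X : measurable X -> (m1 \x m2)%E X = m mf X.
  apply: product_measure_unique => B C mB mC.
  rewrite /m /= /mscale /= /pushforward /=.
  have -> : f @^-1` (B `*` C) = ((fun x : R => k * x + a) @^-1` B) `*`
     ((fun x => k *: x + w) @^-1` C) by [].
  rewrite product_measure1E; last 2 first.
  - rewrite -[X in measurable X]setTI.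
    have : measurable_fun [set: measurableTypeR R]
        (fun x : measurableTypeR R => k * x + a : measurableTypeR R).
      by apply: measurable_funD => //; apply: measurable_funM.
    by apply.
  - by rewrite -[X in measurable X]setTI; exact: measurable_affine.
  rewrite -[m1 B](lebesgue_measure_affine a k0 mB) -[m2 C](IH w _ mC).
  by rewrite exprS EFinM; rewrite -!muleA; congr (_ * _)%E; rewrite muleCA.
rewrite /= /pushforward.
rewrite [RHS]mE; last by rewrite -[X in measurable X]setTI; exact: measurable_rv_cons.
rewrite /m /= /mscale /= /pushforward /=; congr (_ * (lebesgue_measure \x m2) _)%E.
by apply/seteqP; split => -[b x] /=; rewrite rv_cons_affine.
Qed.

End affine_change_of_variables.

(** * Euclidean distance, balls and their volumes *)

Section euclidean_geometry.
Context {R : realType} {d : nat}.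
Implicit Types (x y z v : 'rV[R]_d).

Let sum_sqr_ge0 (u : 'I_d -> R) : 0 <= \sum_(i < d) u i ^+ 2.
Proof. by apply: sumr_ge0 => i _; exact: sqr_ge0. Qed.

(** With a and b the norms of u and w, expanding the nonnegative sum of (b u_i - a w_i)^2 gives 2ab
    (ab - C) >= 0, C being the scalar product. Dividing by 2ab requires both norms to be nonzero, so
    the degenerate cases come first. *)
Lemma cauchy_schwarz_sum (u w : 'I_d -> R) :
  \sum_(i < d) u i * w i <=
  Num.sqrt (\sum_(i < d) u i ^+ 2) * Num.sqrt (\sum_(i < d) w i ^+ 2).
Proof.
set A := \sum_(i < d) u i ^+ 2; set B := \sum_(i < d) w i ^+ 2.
set C := \sum_(i < d) _.
have [A0|A0] := eqVneq A 0.
  have u0 i : u i = 0.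
    apply/eqP; rewrite -sqrf_eq0; apply/eqP.
    by apply: (psumr_eq0P _ A0) => // j _; exact: sqr_ge0.
  by rewrite /C big1 ?mulr_ge0 ?sqrtr_ge0// => i _; rewrite u0 mul0r.
have [B0|B0] := eqVneq B 0.
  have w0 i : w i = 0.
    apply/eqP; rewrite -sqrf_eq0; apply/eqP.
    by apply: (psumr_eq0P _ B0) => // j _; exact: sqr_ge0.
  by rewrite /C big1 ?mulr_ge0 ?sqrtr_ge0// => i _; rewrite w0 mulr0.
have A1 : 0 < A by rewrite lt_neqAle eq_sym A0 sum_sqr_ge0.
have B1 : 0 < B by rewrite lt_neqAle eq_sym B0 sum_sqr_ge0.
set a := Num.sqrt A; set b := Num.sqrt B.
have a0 : 0 < a by rewrite sqrtr_gt0.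
have b0 : 0 < b by rewrite sqrtr_gt0.
have aA : a ^+ 2 = A by rewrite sqr_sqrtr// ltW.
have bB : b ^+ 2 = B by rewrite sqr_sqrtr// ltW.
have : 0 <= \sum_(i < d) (b * u i - a * w i) ^+ 2 by exact: sum_sqr_ge0.
have -> : \sum_(i < d) (b * u i - a * w i) ^+ 2 =
    b ^+ 2 * A - 2 * (a * b) * C + a ^+ 2 * B.
  rewrite /A /B /C !mulr_sumr -sumrB -big_split/=.
  by apply: eq_bigr => i _; lra.
rewrite -aA -bB => h.
have : 0 <= (2 * (a * b)) * (a * b - C) by move: h; lra.
by rewrite pmulr_rge0 ?subr_ge0// mulr_gt0// mulr_gt0.
Qed.

Lemma edist_ge0 x y : 0 <= edist x y.
Proof. exact: sqrtr_ge0. Qed.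

Lemma edistxx x : edist x x = 0.
Proof. by rewrite /edist big1 ?sqrtr0// => i _; rewrite subrr expr0n. Qed.

Lemma edistC x y : edist x y = edist y x.
Proof. by congr Num.sqrt; apply: eq_bigr => i _; rewrite -sqrrN opprB. Qed.

Lemma edist_triangle y x z : edist x z <= edist x y + edist y z.
Proof.
rewrite -(@ler_pXn2r _ 2)// ?nnegrE ?addr_ge0 ?edist_ge0//.
rewrite sqrrD !sqr_sqrtr ?sum_sqr_ge0//.
have := cauchy_schwarz_sum (fun i => x ord0 i - y ord0 i)
  (fun i => y ord0 i - z ord0 i).
rewrite -/(edist x y) -/(edist y z) => h.
have -> : \sum_(i < d) (x ord0 i - z ord0 i) ^+ 2 =
  \sum_(i < d) (x ord0 i - y ord0 i) ^+ 2 +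
  2 * \sum_(i < d) (x ord0 i - y ord0 i) * (y ord0 i - z ord0 i) +
  \sum_(i < d) (y ord0 i - z ord0 i) ^+ 2.
  by rewrite mulr_sumr -!big_split/=; apply: eq_bigr => i _; lra.
by move: h; lra.
Qed.

Lemma edist_affine (k : R) v x y : 0 <= k ->
  edist (k *: x + v) (k *: y + v) = k * edist x y.
Proof.
move=> k0; rewrite /edist.
under eq_bigr => i _.
  rewrite !mxE opprD addrACA subrr addr0 -mulrBr exprMn.
  over.
by rewrite -mulr_sumr sqrtrM ?sqr_ge0// sqrtr_sqr ger0_norm.
Qed.

Lemma measurable_edist (dT : measure_display) (T : measurableType dT)
    (f g : T -> 'rV[R]_d) :
  measurable_fun setT f -> measurable_fun setT g ->
  measurable_fun setT (fun t => edist (f t) (g t) : measurableTypeR R).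
Proof.
move=> mf mg.
have ms : measurable_fun setT (@Num.sqrt R : measurableTypeR R -> measurableTypeR R).
  by apply: continuous_measurable_fun; exact: sqrt_continuous.
apply: (measurableT_comp ms); apply: measurable_sum => i.
apply: measurable_funX; apply: measurable_funB.
  exact: (measurableT_comp (@measurable_rv_coord R d i) mf).
exact: (measurableT_comp (@measurable_rv_coord R d i) mg).
Qed.

Lemma measurable_edist_lt (dT : measure_display) (T : measurableType dT)
    (f g : T -> 'rV[R]_d) (l : R) :
  measurable_fun setT f -> measurable_fun setT g ->
  measurable [set t | edist (f t) (g t) < l].
Proof.
move=> mf mg; rewrite -[X in measurable X]setTI.
have -> : [set t | edist (f t) (g t) < l] =
  (fun t => edist (f t) (g t) : measurableTypeR R) @^-1` `]-oo, l[%classic.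
  by apply/seteqP; split => t /=; rewrite in_itv.
by apply: measurable_edist => //; exact: measurable_itv.
Qed.

Lemma measurable_eball x (l : R) : measurable (eball x l).
Proof. exact: (@measurable_edist_lt _ _ (cst x) id). Qed.

Lemma continuous_edist x : continuous (edist x : 'rV[R]_d -> R).
Proof.
move=> y; rewrite /edist.
apply: (@continuous_comp _ _ _
  (fun y : 'rV[R]_d => \sum_(i < d) (x ord0 i - y ord0 i) ^+ 2)).
  move: y; apply: (@continuous_big _ _ +%R 0 predT).
    exact: add_continuous.
  move=> i _ y.
  apply: (@continuous_comp _ _ _ (fun y : 'rV[R]_d => x ord0 i - y ord0 i)
    (fun t => t ^+ 2)); last exact: exprn_continuous.
  apply: continuousB; first exact: cst_continuous.
  exact: coord_continuous.
exact: sqrt_continuous.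
Qed.

Lemma open_eball x (l : R) : open (eball x l).
Proof.
have -> : eball x l = edist x @^-1` [set t | t < l] by [].
apply: open_comp; last exact: open_lt.
by move=> y _; exact: continuous_edist.
Qed.

(** Density of the rational points, which turns uncountable intersections into countable ones. *)
Lemma open_rat_point (U : set 'rV[R]_d) x : open U -> U x ->
  exists q : 'rV[rat]_d, U (map_mx ratr q).
Proof.
move=> oU Ux; have /nbhs_ballP[e /= e0 eU] : nbhs x U by exact: open_nbhs_nbhs.
have h i : {q : rat | ratr q \in `]x ord0 i - e, x ord0 i + e[}.
  by apply/cid/rat_in_itvoo; lra.
exists (\row_i projT1 (h i)); apply: eU; split => // i j; rewrite ord1.
rewrite !mxE; case: (h j) => q /=; rewrite in_itv/= => /andP[q1 q2].
by rewrite /ball/= ltr_norml; lra.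
Qed.

Lemma le_edist_setP x (A : set 'rV[R]_d) (l : R) :
  (l%:E <= edist_set x A)%E <-> (forall y, A y -> l <= edist x y).
Proof.
split=> [h y Ay|h].
  by rewrite -lee_fin (le_trans h)//; apply: ereal_inf_lbound; exists y.
by apply: le_ereal_inf_tmp => _ [y Ay <-]; rewrite lee_fin h.
Qed.

(** The distance condition only has to be tested at rational points outside [Lam]: the complement is
    open, so a point of it closer than r to x can be replaced by a rational one. This leaves a
    countable intersection. *)
Lemma measurable_interior_at (r : R) (Lam : set 'rV[R]_d) :
  closed Lam -> measurable Lam -> measurable (interior_at r Lam).
Proof.
move=> cL mL.
(* Rational points inside [Lam] impose no condition. *)
pose F (q : 'rV[rat]_d) : set 'rV[R]_d := if map_mx ratr q \in Lam then setT
  else ~` [set x | edist x (map_mx ratr q) < r].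
have -> : interior_at r Lam = Lam `&`
    \bigcap_n (if choice.unpickle n is Some q then F q else setT).
  apply/seteqP; split => x [Lx].
    move=> /le_edist_setP h; split => // n _; case: choice.unpickle => // q.
    rewrite /F; case: ifPn => // /negP qL /=; apply/negP; rewrite -leNgt.
    by apply: h => /= Lq; apply: qL; rewrite inE.
  move=> h; split => //; apply/le_edist_setP => y /= Ly.
  rewrite leNgt; apply/negP => xy.
  have [] := @open_rat_point (~` Lam `&` eball x r) y.
  - by apply: openI; [exact: closed_openC|exact: open_eball].
  - by split.
  move=> q [/= Lq xq]; have := h (choice.pickle q) I; rewrite choice.pickleK /F memNset//.
  apply: measurableI => //; apply: bigcapT_measurable => n.
case: choice.unpickle => // q; rewrite /F; case: ifPn => // _.
by apply: measurableC; exact: (@measurable_edist_lt _ _ id (cst _)).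
Qed.

Lemma interior_at_eball (r : R) (Lam : set 'rV[R]_d) x :
  interior_at r Lam x -> eball x r `<=` Lam.
Proof.
move=> [_ /le_edist_setP h] y; rewrite /eball /= ltNge.
by apply: contraNP => /h.
Qed.

(** The map y -> k y + x carries the ball of radius l about 0 onto the ball of radius k l about x.
    The case k = 1 is translation invariance; k = 2 gives the factor 2^d for balls of radius 2r. *)
Lemma lebesgue_eballM (k l : R) x : 0 < k ->
  (lebesgue_rV (eball x (k * l)%R) =
   (k ^+ d)%:E * lebesgue_rV (eball (0 : 'rV[R]_d) l))%E.
Proof.
move=> k0.
have E y : edist x (k *: y + x) = k * edist 0 y.
  by rewrite -{1}(add0r x) -[X in edist (X + _)](scaler0 _ k) edist_affine// ltW.
rewrite -[LHS](lebesgue_rV_affine x k0); last exact: measurable_eball.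
congr (_ * lebesgue_rV _)%E; apply/seteqP; split => y; rewrite /eball /=.
  by rewrite E ltr_pM2l.
by rewrite E ltr_pM2l.
Qed.

(** Finitely many balls of radius r cover the set, and each has the finite volume of the ball about
    0. *)
Lemma compact_lebesgue_lty (Lam : set 'rV[R]_d) (r : R) : 0 < r ->
  (lebesgue_rV (eball (0 : 'rV[R]_d) r) < +oo)%E ->
  compact Lam -> measurable Lam -> (lebesgue_rV Lam < +oo)%E.
Proof.
move=> r0 roo; rewrite compact_cover => cL mL.
have [] := cL 'rV[R]_d setT (fun x => eball x r).
- by move=> x _; exact: open_eball.
- by move=> x Lx; exists x => //; rewrite /eball /= edistxx.
move=> D _ LD; apply: (@le_lt_trans _ _
  (\sum_(x <- D) lebesgue_rV (eball x r))%E).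
  have mD : measurable (cover [set` D] (fun x => eball x r)).
    rewrite /cover bigcup_fset; apply: bigsetU_measurable => x _.
    exact: measurable_eball.
  apply: (@le_trans _ _ (lebesgue_rV (cover [set` D] (fun x => eball x r)))).
    by apply: le_measure; rewrite ?inE.
  rewrite /cover bigcup_fset.
  elim: (enum_fset D) => [|x s IH]; first by rewrite !big_nil measure0.
  rewrite !big_cons; apply: le_trans (leeD _ IH) => //.
  apply: measureU2; first exact: measurable_eball.
  by apply: bigsetU_measurable => y _; exact: measurable_eball.
apply: lte_sum_pinfty => x _; rewrite -[r]mul1r lebesgue_eballM//.
by rewrite expr1n mul1e.
Qed.

End euclidean_geometry.
(** * Measurability of the moves *)

Section point_counts.
Context {R : realType} {d : nat}.
Implicit Types (X : conf R d) (B : set 'rV[R]_d).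

Lemma npointsE B X : npoints B X = (\sum_(y <- enum_fset X) (y \in B))%N.
Proof.
rewrite /npoints card_fset_sum1 -(big_fset_condE _ X (fun x => x \in B) (fun=> 1%N)).
by rewrite big_mkcond; apply: eq_bigr => y _; case: (y \in B).
Qed.

Lemma npoints_eq0P B X : npoints B X = 0%N <-> [set` X] `<=` ~` B.
Proof.
rewrite npointsE; split=> [/eqP|h].
  rewrite sum_nat_seq_eq0 => /allP h y /= yX By.
  by have := h y yX; rewrite /= mem_set.
apply/eqP; rewrite sum_nat_seq_eq0; apply/allP => y yX /=.
by rewrite memNset//; exact: h.
Qed.

Lemma measurable_npoints B : measurable B -> measurable_fun setT (npoints B : conf R d -> nat).
Proof.
move=> mB _ Y _; rewrite setTI.
have -> : npoints B @^-1` Y = \bigcup_(k in Y) [set X | npoints B X = k].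
  by apply/seteqP; split=> [X YX|X [k Yk] /= ->//]; exists (npoints B X).
apply: bigcup_measurable => k _; apply: sub_sigma_algebra.
by exists (B, k).
Qed.

Lemma measurable_fun_conf (dT : measure_display) (T : measurableType dT)
    (f : T -> conf R d) :
  (forall B, measurable B -> measurable_fun setT (fun t => npoints B (f t))) ->
  measurable_fun setT f.
Proof.
move=> mf _ Y mY; rewrite setTI.
have := mY; apply: (smallest_sub (X := [set A | measurable (f @^-1` A)])).
  split=> /=.
  - by rewrite preimage_set0.
  - by move=> A mA; rewrite setTD preimage_setC; exact: measurableC.
  - by move=> F mF; rewrite preimage_bigcup; exact: bigcupT_measurable.
move=> A [[B k]/= mB <-].
by have /= := mf B mB measurableT [set k] I; rewrite setTI.
Qed.

End point_counts.

(** * Measurability of counts that depend on a parameter *)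

Section random_sums.
Context {R : realType} {d : nat} {dS : measure_display} {S : measurableType dS}.
Implicit Types (F : set ('rV[R]_d * S)).

Let sum_indic F (p : S * conf R d) : \bar R :=
  (\sum_(y <- enum_fset p.2) (\1_F (y, p.1))%:E)%E.

Let sum_indicE F p :
  sum_indic F p = ((\sum_(y <- enum_fset p.2) ((y, p.1) \in F))%N%:R)%:E.
Proof.
by rewrite /sum_indic sumEFin natr_sum; congr EFin; apply: eq_bigr => y _; rewrite indicE.
Qed.

(** Dynkin induction from rectangles. For [A]*[B] the sum is the indicator of [B] times the number
    of points in [A]; a complement is subtracted from the finite total count, and a disjoint union
    gives a series. *)
Let measurable_sum_indic F : measurable F -> measurable_fun setT (sum_indic F).
Proof.
rewrite measurable_prod_measurableType; move: F.
apply: (@dynkin_induction _ _ _ [set F | measurable_fun setT (sum_indic F)]).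
- by rewrite -measurable_prod_measurableType.
- move=> _ _ [A mA [B mB <-]] [C mC [D mD <-]].
  exists (A `&` C); first exact: measurableI.
  by exists (B `&` D); [exact: measurableI|rewrite setXI].
- rewrite /=.
  have -> : sum_indic setT = (fun p => ((npoints setT p.2)%:R)%:E).
    apply/funext => p; rewrite sum_indicE npointsE.
    by congr (_%:R%:E); apply: eq_bigr => y _; rewrite !in_setT.
  apply/measurable_EFinP.
  apply: (@measurableT_comp _ _ _ _ _ _ (fun k : nat => k%:R : measurableTypeR R)) => //.
  by apply: measurableT_comp; [exact: measurable_npoints|exact: measurable_snd].
- move=> _ [A mA [B mB <-]] /=.
  have -> : sum_indic (A `*` B) = (fun p => (\1_B p.1 * (npoints A p.2)%:R)%:E).
    apply/funext => p; rewrite sum_indicE npointsE indicE !natr_sum mulr_sumr.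
    by congr EFin; apply: eq_bigr => y _; rewrite in_setX/= mulrC -natrM mulnb.
  apply/measurable_EFinP; apply: measurable_funM.
    by apply: measurableT_comp; [exact: measurable_indic|exact: measurable_fst].
  apply: (@measurableT_comp _ _ _ _ _ _ (fun k : nat => k%:R : measurableTypeR R)) => //.
  by apply: measurableT_comp; [exact: measurable_npoints|exact: measurable_snd].
- move=> F mF /= PF.
  have -> : sum_indic (~` F) = (fun p => ((npoints setT p.2)%:R)%:E - sum_indic F p)%E.
    apply/funext => p; rewrite !sum_indicE npointsE -EFinB; congr EFin.
    rewrite !natr_sum -sumrB; apply: eq_bigr => y _; rewrite in_setT in_setC.
    by case: (_ \in F); rewrite /= ?subrr ?subr0.
  apply: emeasurable_funB => //; apply/measurable_EFinP.
  apply: (@measurableT_comp _ _ _ _ _ _ (fun k : nat => k%:R : measurableTypeR R)) => //.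
  by apply: measurableT_comp; [exact: measurable_npoints|exact: measurable_snd].
- move=> F mF tF PF /=.
  have -> : sum_indic (\bigcup_k F k) =
      (fun p => \sum_(0 <= k <oo) sum_indic (F k) p)%E.
    apply/funext => p; rewrite /sum_indic.
    rewrite nneseries_sum//.
    by apply: eq_bigr => y _; rewrite indic_bigcup.
  refine (@ge0_emeasurable_sum _ _ R setT (fun k => sum_indic (F k)) predT _ _).
    by move=> k p _ _; apply: sume_ge0 => y _; rewrite lee_fin.
  by move=> k _; exact: PF.
Qed.

Lemma measurable_count F : measurable F -> measurable_fun setT
  (fun p : S * conf R d => (\sum_(y <- enum_fset p.2) ((y, p.1) \in F))%N).
Proof.
move=> mF _ Y _; rewrite setTI.
have -> : (fun p : S * conf R d => (\sum_(y <- enum_fset p.2) ((y, p.1) \in F))%N) @^-1` Y =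
  \bigcup_(k in Y) (sum_indic F @^-1` [set k%:R%:E]).
  apply/seteqP; split=> [p Yp|p [k Yk] /=].
    by exists (\sum_(y <- enum_fset p.2) ((y, p.1) \in F))%N => //=; rewrite sum_indicE.
  by rewrite sum_indicE => -[] /eqP; rewrite eqr_nat => /eqP ->.
apply: bigcup_measurable => k _; rewrite -[X in measurable X]setTI.
by apply: measurable_sum_indic => //; exact: emeasurable_set1.
Qed.

(** Existence means a nonzero count. Events of the form: some center is in a given relation to a
    parameter, are all reduced to this. *)
Lemma measurable_exists F : measurable F ->
  measurable [set p : S * conf R d | exists2 y, y \in p.2 & F (y, p.1)].
Proof.
move=> mF; have := measurable_count mF measurableT (Y := ~` [set 0%N]) I.
rewrite setTI; congr measurable; apply/seteqP; split=> p /=.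
  move=> /eqP; rewrite sum_nat_seq_eq0 => /allPn[y yp]; rewrite eqb0 negbK inE => Fy.
  by exists y.
move=> [y yp Fy]; apply/eqP; rewrite sum_nat_seq_eq0; apply/allPn; exists y => //.
by rewrite mem_set.
Qed.

End random_sums.

(** * Deletion, insertion and the hard-core constraint *)

Section measurability_of_moves.
Context {R : realType} {d : nat}.
Implicit Types (X : conf R d) (B T : set 'rV[R]_d) (x y : 'rV[R]_d).

Lemma edist_eq0 x y : edist x y = 0 -> x = y.
Proof.
move=> /eqP; rewrite sqrtr_eq0 => h; apply/rowP => i; apply/eqP.
rewrite -subr_eq0 -sqrf_eq0; apply/eqP.
apply: (psumr_eq0P (P := predT) (F := fun i => (x ord0 i - y ord0 i) ^+ 2)) => //.
  by move=> j _; exact: sqr_ge0.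
by apply/eqP; rewrite eq_le h; apply: sumr_ge0 => j _; exact: sqr_ge0.
Qed.

Lemma measurable_diagonal : measurable [set p : 'rV[R]_d * 'rV[R]_d | p.1 = p.2].
Proof.
have -> : [set p : 'rV[R]_d * 'rV[R]_d | p.1 = p.2] =
  (fun p => edist p.1 p.2 : measurableTypeR R) @^-1` [set 0].
  apply/seteqP; split=> -[x y] /=; last exact: edist_eq0.
  by move=> ->; exact: edistxx.
rewrite -[X in measurable X]setTI; apply: measurable_edist => //.
Qed.

Lemma npoints_remove_ball B r X x : npoints B (remove_ball r X x) =
  (\sum_(y <- enum_fset X) ((y, x) \in [set p | B p.1 /\ ~ eball p.2 r p.1]))%N.
Proof.
rewrite npointsE /remove_ball.
rewrite -(big_fset_condE _ X (fun y => y \notin eball x r) (fun y => nat_of_bool (y \in B))).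
rewrite big_mkcond; apply: eq_bigr => y _.
apply/esym; case: ifPn => [|/negPn] h.
  congr nat_of_bool; apply/idP/idP; rewrite !inE /=; first by case.
  by move=> By; split => // xy; move: h; rewrite notin_setE.
by rewrite memNset// => -[_]; apply; move: h; rewrite inE.
Qed.

Lemma measurable_remove_ball r :
  measurable_fun setT (fun p : conf R d * 'rV[R]_d => remove_ball r p.1 p.2).
Proof.
apply: measurable_fun_conf => B mB.
have mF : measurable [set p : 'rV[R]_d * 'rV[R]_d | B p.1 /\ ~ eball p.2 r p.1].
  apply: measurableI; last by apply: measurableC; exact: measurable_edist_lt.
  by rewrite -[X in measurable X]setTI; exact: measurable_fst.
rewrite (_ : (fun t => _) = (fun p : 'rV[R]_d * conf R d =>
  (\sum_(y <- enum_fset p.2) ((y, p.1) \in [set p | B p.1 /\ ~ eball p.2 r p.1]%classic))%N)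
   \o (fun p => (p.2, p.1))).
  apply: measurableT_comp; first exact: measurable_count.
  exact: measurable_swap.
by apply/funext => p /=; exact: npoints_remove_ball.
Qed.

Lemma npoints_setU1 B X x : npoints B (x |` X)%fset =
  (npoints B X + (x \in B) * (x \notin X))%N.
Proof.
have [xX|xX] := boolP (x \in X).
  by rewrite /= muln0 addn0 (mem_fset1U xX).
by rewrite muln1 !npointsE big_fsetU1//= addnC.
Qed.

Lemma measurable_mem_conf :
  measurable [set p : conf R d * 'rV[R]_d | p.2 \in p.1].
Proof.
have -> : [set p : conf R d * 'rV[R]_d | p.2 \in p.1] =
  (fun p => (p.2, p.1)) @^-1` [set p : 'rV[R]_d * conf R d | exists2 y, y \in p.2 & y = p.1].
  apply/seteqP; split=> -[X x] /=; first by exists x.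
  by move=> [y yX <-].
rewrite -[X in measurable X]setTI; apply: measurable_swap => //.
exact: (measurable_exists measurable_diagonal).
Qed.

Lemma measurable_insert :
  measurable_fun setT (fun p : conf R d * 'rV[R]_d => (p.2 |` p.1)%fset : conf R d).
Proof.
apply: measurable_fun_conf => B mB.
under eq_fun do rewrite npoints_setU1.
apply: measurable_fun_addn.
  by apply: measurableT_comp; [exact: measurable_npoints|exact: measurable_fst].
have -> : (fun p : conf R d * 'rV[R]_d => ((p.2 \in B) * (p.2 \notin p.1))%N) =
  (fun p => if p \in [set p | B p.2] `\` [set p : conf R d * 'rV[R]_d | p.2 \in p.1] then 1%N else 0%N).
  apply/funext => p; rewrite mulnb; case: ifPn => /=; rewrite ?inE ?notin_setE.
    by move=> [/= /mem_set -> /negP ->].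
  by move=> h; apply/eqP; rewrite eqb0; apply/negP => /andP[/set_mem Bp /negP pp]; exact: h.
apply: measurable_fun_ifT => //; apply: (@measurable_fun_bool _ _ _ _ true).
rewrite setTI preimage_mem_true; apply: measurableD; last exact: measurable_mem_conf.
by rewrite -[X in measurable X]setTI; exact: measurable_snd.
Qed.

Lemma npoints_setD1 B X x : npoints B (X `\ x)%fset =
  (npoints B X - (x \in B) * (x \in X))%N.
Proof.
have [xX|xX] := boolP (x \in X).
  rewrite muln1 !npointsE [in RHS](big_fsetD1 x)//= [X in _ = (X - _)%N]addnC addnK//.
by rewrite muln0 subn0 mem_fsetD1.
Qed.

Lemma measurable_delete :
  measurable_fun setT (fun p : conf R d * 'rV[R]_d => (p.1 `\ p.2)%fset : conf R d).
Proof.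
apply: measurable_fun_conf => B mB.
under eq_fun do rewrite npoints_setD1.
apply: measurable_fun_subn.
  by apply: measurableT_comp; [exact: measurable_npoints|exact: measurable_fst].
have -> : (fun p : conf R d * 'rV[R]_d => ((p.2 \in B) * (p.2 \in p.1))%N) =
  (fun p => if p \in [set p | B p.2] `&` [set p : conf R d * 'rV[R]_d | p.2 \in p.1] then 1%N else 0%N).
  apply/funext => p; rewrite mulnb; case: ifPn => /=; rewrite ?inE ?notin_setE.
    by move=> [/= /mem_set -> ->].
  by move=> h; apply/eqP; rewrite eqb0; apply/negP => /andP[/set_mem Bp pp]; exact: h.
apply: measurable_fun_ifT => //; apply: (@measurable_fun_bool _ _ _ _ true).
rewrite setTI preimage_mem_true; apply: measurableI; last exact: measurable_mem_conf.
by rewrite -[X in measurable X]setTI; exact: measurable_snd.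
Qed.

(** The set F(X). The point x is tested against every center, itself included, so for r > 0 a free
    point is never already a center. *)
Definition free (r : R) T X : set 'rV[R]_d :=
  [set x | T x /\ forall y, y \in X -> 2 * r <= edist x y].

Lemma measurable_free2 r T : measurable T ->
  measurable [set p : conf R d * 'rV[R]_d | free r T p.1 p.2].
Proof.
move=> mT.
have -> : [set p : conf R d * 'rV[R]_d | free r T p.1 p.2] = [set p | T p.2] `\`
  ((fun p => (p.2, p.1)) @^-1` [set p : 'rV[R]_d * conf R d |
     exists2 y, y \in p.2 & edist p.1 y < 2 * r]).
  apply/seteqP; split=> -[X x] /= [Tx h]; split => //=.
    by move=> [y yX]; rewrite ltNge h.
  by move=> y yX; rewrite leNgt; apply/negP => xy; apply: h; exists y.
apply: measurableD.
  by rewrite -[X in measurable X]setTI; exact: measurable_snd.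
rewrite -[X in measurable X]setTI; apply: measurable_swap => //.
apply: (measurable_exists (F := [set p | edist p.2 p.1 < 2 * r])).
exact: measurable_edist_lt.
Qed.

Lemma measurable_free r T X : measurable T -> measurable (free r T X).
Proof.
move=> mT; have := measurable_xsection X (measurable_free2 r mT).
by congr measurable; apply/seteqP; split=> x; rewrite /xsection/= inE.
Qed.

(** A violation is a pair of distinct centers at distance less than 2r; the two existential
    quantifiers over centers are handled by using [measurable_exists] twice. *)
Lemma measurable_hard_core (r : R) : measurable (@hard_core R d r).
Proof.
have mG : measurable [set p : 'rV[R]_d * 'rV[R]_d | edist p.2 p.1 < 2 * r /\ p.1 <> p.2].
  apply: measurableI; first exact: measurable_edist_lt.
  by apply: measurableC; exact: measurable_diagonal.
have mE := measurable_exists mG.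
have mE2 := measurable_exists mE.
have -> : @hard_core R d r = ~` ((fun X : conf R d => (X, X)) @^-1`
  [set p | exists2 y, y \in p.2 &
    [set p : 'rV[R]_d * conf R d | exists2 z, z \in p.2 &
       edist p.1 z < 2 * r /\ z <> p.1] (y, p.1)]).
  apply/seteqP; split=> X; rewrite /hard_core /=.
    move=> h [y yX [z zX [yz zy]]]; move: yz; rewrite ltNge h//.
    by apply/eqP => yz; exact: zy.
  move=> h x y xX yX xy; rewrite leNgt; apply/negP => xy2; apply: h.
  by exists x => //; exists y => //; split => // yx; move: xy; rewrite yx eqxx.
apply: measurableC; rewrite -[X in measurable X]setTI.
have : measurable_fun setT (fun X : conf R d => (X, X)) by exact: measurable_fun_pair.
by apply => //; apply: mE2.
Qed.

Lemma Omega_npoints (r : R) (Lam tau : set 'rV[R]_d) : Omega r Lam tau =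
  [set X | npoints (~` allowed r Lam tau) X = 0%N] `&` hard_core r.
Proof.
apply/seteqP; split=> X [h hX]; split => //.
  by apply/npoints_eq0P; rewrite setCK.
by move/npoints_eq0P: h; rewrite setCK.
Qed.

Lemma measurable_Omega (r : R) (Lam tau : set 'rV[R]_d) :
  measurable (allowed r Lam tau) -> measurable (Omega r Lam tau).
Proof.
move=> mT; rewrite Omega_npoints; apply: measurableI; last exact: measurable_hard_core.
have /= := measurable_npoints (measurableC mT) measurableT (Y := [set 0%N]) I.
by rewrite setTI.
Qed.

End measurability_of_moves.
(** * Mecke's formula *)

Section reduced_campbell.
Context {R : realType} {d : nat}.
Implicit Types (X : conf R d) (F : set (conf R d * 'rV[R]_d)).

(** The sum inside the reduced Campbell measure: each center is paired with the configuration that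
    remains without it. *)
Definition reduced_count F X : nat :=
  (\sum_(y <- enum_fset X) (((X `\ y)%fset, y) \in F))%N.

Lemma measurable_reduced_count F :
  measurable F -> measurable_fun setT (reduced_count F).
Proof.
move=> mF; pose F' : set ('rV[R]_d * conf R d) :=
  (fun p : 'rV[R]_d * conf R d => ((p.2 `\ p.1)%fset, p.1)) @^-1` F.
have mF' : measurable F'.
  rewrite -[X in measurable X]setTI.
  suff : measurable_fun setT (fun p : 'rV[R]_d * conf R d =>
      ((p.2 `\ p.1)%fset : conf R d, p.1)) by apply.
  apply: measurable_fun_pair; last exact: measurable_fst.
  have := measurableT_comp (@measurable_delete R d)
    (@measurable_swap _ _ 'rV[R]_d (conf R d)).
  by [].
have mdiag : measurable_fun setT (fun X : conf R d => (X, X)).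
  exact: measurable_fun_pair.
rewrite (_ : reduced_count F = (fun p : conf R d * conf R d =>
  (\sum_(y <- enum_fset p.2) ((y, p.1) \in F'))%N) \o (fun X => (X, X))).
  by apply: measurableT_comp; [exact: measurable_count|].
by apply/funext.
Qed.

Lemma measurable_reduced_countE F : measurable F ->
  measurable_fun setT (fun X => ((reduced_count F X)%:R)%:E : \bar R).
Proof.
move=> mF; apply/measurable_EFinP.
apply: (@measurableT_comp _ _ _ _ _ _ (fun k : nat => k%:R : measurableTypeR R)) => //.
exact: measurable_reduced_count.
Qed.

Variable Pi : probability (conf R d) R.

(** The reduced Campbell measure of [Pi]. It is given a measure structure so that it can be
    identified by its values on a pi-system. *)
Definition campbell F : \bar R := (\int[Pi]_X ((reduced_count F X)%:R)%:E)%E.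

Let campbell0 : campbell set0 = 0%E.
Proof.
rewrite /campbell integral0_eq// => X _; rewrite /reduced_count big1// => y _.
by rewrite in_set0.
Qed.

Let campbell_ge0 F : (0 <= campbell F)%E.
Proof. by apply: integral_ge0 => X _; rewrite lee_fin. Qed.

Let campbell_sigma_additive : semi_sigma_additive campbell.
Proof.
move=> F mF tF mUF.
rewrite [X in _ --> X](_ : _ = \sum_(n <oo) campbell (F n))%E.
  by apply/cvg_closeP; split; [exact: is_cvg_nneseries|rewrite closeE].
rewrite -integral_nneseries//; last by move=> n; exact: measurable_reduced_countE.
apply: eq_integral => X _.
have E G : (((reduced_count G X)%:R)%:E =
    \sum_(y <- enum_fset X) (\1_G ((X `\ y)%fset, y))%:E :> \bar R)%E.
  by rewrite sumEFin natr_sum; congr EFin; apply: eq_bigr => y _; rewrite indicE.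
under [RHS]eq_eseriesr do rewrite E.
rewrite E nneseries_sum//; apply: eq_bigr => y _.
by rewrite indic_bigcup.
Qed.

HB.instance Definition _ := isMeasure.Build _ _ _ campbell
  campbell0 campbell_ge0 campbell_sigma_additive.

End reduced_campbell.

(** * Counts in finite partitions and the proof of Mecke's formula *)

Section mecke.
Context {R : realType} {d : nat}.
Variables (lam : R) (T : set 'rV[R]_d) (Pi : probability (conf R d) R).
Hypotheses (lam0 : 0 <= lam) (mT : measurable T)
  (T_lty : (lebesgue_rV T < +oo)%E) (PiP : is_poisson_process lam T Pi).
Implicit Types (X : conf R d) (J : finType).

Let m (B : set 'rV[R]_d) : R := lam * fine (lebesgue_rV (B `&` T)).

Let poisson_weight (a : R) (k : nat) : R := expR (- a) * a ^+ k / k`!%:R.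

(** This recursion is Mecke's formula for a single cell. *)
Let poisson_weightS a k : poisson_weight a k.+1 * k.+1%:R = a * poisson_weight a k.
Proof.
rewrite /poisson_weight exprS factS natrM.
have h1 : k.+1%:R != 0 :> R by rewrite pnatr_eq0.
have h2 : k`!%:R != 0 :> R by rewrite pnatr_eq0 -lt0n fact_gt0.
have E (b e f s : R) : e * (a * b) / (s * f) * s = a * (e * b / f) * (s^-1 * s).
  by rewrite invfM; lra.
by rewrite E mulVf// mulr1.
Qed.

Let col J (c : 'rV[R]_d -> J) X : {ffun J -> nat} :=
  [ffun j => npoints (c @^-1` [set j]) X].

(* A finite measurable partition is encoded as a map c to a finite type. *)
Let coloring J (c : 'rV[R]_d -> J) := forall j, measurable (c @^-1` [set j]).

Let bump_col J (q : {ffun J -> nat}) j := [ffun i => (q i + (i == j))%N].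

(** Deleting y lowers the count of its own color by 1. The truncated subtraction is exact because y
    is counted there. *)
Let col_delete J (c : 'rV[R]_d -> J) X y (q : {ffun J -> nat}) : y \in X ->
  (col c (X `\ y)%fset == q) = (col c X == bump_col q (c y)).
Proof.
move=> yX.
have le1 i : ((i == c y) <= npoints (c @^-1` [set i]) X)%N.
  rewrite npointsE (big_fsetD1 y)//=; case: eqP => //= ->.
  by rewrite (_ : y \in _) ?inE.
have E i : npoints (c @^-1` [set i]) (X `\ y)%fset =
    (npoints (c @^-1` [set i]) X - (i == c y))%N.
  rewrite npoints_setD1 yX muln1; congr (_ - nat_of_bool _)%N.
  by apply/idP/eqP; rewrite inE /= => ->.
apply/eqP/eqP => /ffunP h; apply/ffunP => i; have := h i; rewrite !ffunE E => h1.
  by rewrite -h1 subnK.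
by rewrite h1 addnK.
Qed.

(** To leave counts q after losing a center of color j, X must have counts q plus one in cell j, and
    then any of its q_j + 1 centers of that color may be the one removed. *)
Let reduced_count_col J (c : 'rV[R]_d -> J) (q : {ffun J -> nat}) j X :
  reduced_count [set p | col c p.1 = q /\ c p.2 = j] X =
  ((q j).+1 * (col c X == bump_col q j))%N.
Proof.
rewrite /reduced_count.
transitivity (\sum_(y <- enum_fset X) (y \in c @^-1` [set j]) * (col c X == bump_col q j))%N.
  rewrite big_seq [RHS]big_seq; apply: eq_bigr => y yX.
  rewrite mulnb; congr nat_of_bool.
  apply/idP/andP; rewrite !inE /=.
    by move=> [/eqP + cy]; rewrite col_delete// cy => ->.
  by move=> [cy]; rewrite -{1}cy -col_delete// => /eqP.
rewrite -big_distrl/= -npointsE.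
case: eqP => [/ffunP /(_ j)|]; last by rewrite !muln0.
by rewrite !ffunE eqxx addn1 => ->.
Qed.

Let measurable_col J (c : 'rV[R]_d -> J) (q : {ffun J -> nat}) : coloring c ->
  measurable [set X | col c X = q].
Proof.
move=> mc.
rewrite (_ : [set X | col c X = q] =
  \bigcap_(j in [set: J]) [set X | npoints (c @^-1` [set j]) X = q j]).
  apply: fin_bigcap_measurable; first exact: finite_finset.
  move=> j _; have := @measurable_npoints R d _ (mc j) measurableT [set q j] I.
  by rewrite setTI.
apply/seteqP; split=> X /=; first by move=> <- j _; rewrite /= ffunE.
by move=> h; apply/ffunP => j; rewrite ffunE; exact: h.
Qed.

Let poisson_col J (c : 'rV[R]_d -> J) (q : {ffun J -> nat}) : coloring c ->
  Pi [set X | col c X = q] = (\prod_j poisson_weight (m (c @^-1` [set j])) (q j))%:E.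
Proof.
move=> mc; have [Pi1 Pi2] := PiP.
have -> : [set X | col c X = q] = [set X | forall i : 'I_#|J|,
    npoints (c @^-1` [set enum_val i]) X = q (enum_val i)].
  apply/seteqP; split=> X /=; first by move=> <- i; rewrite ffunE.
  by move=> h; apply/ffunP => j; rewrite ffunE -(enum_rankK j) h.
rewrite Pi2//; last first.
  by move=> i j _ _ [x [/= xi xj]]; apply: enum_val_inj; rewrite -xi -xj.
have Pi1' B k : measurable B -> Pi [set X | npoints B X = k] = (poisson_weight (m B) k)%:E.
  by move=> mB; exact: Pi1.
rewrite (eq_bigr (fun i => (poisson_weight (m (c @^-1` [set enum_val i]))
  (q (enum_val i)))%:E)); last first.
  by move=> i _; exact: Pi1'.
rewrite -(big_morph _ EFinM erefl); congr EFin.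
rewrite -(big_enum_val (fun j => poisson_weight (m (c @^-1` [set j])) (q j))).
exact: eq_bigl.
Qed.

(** Independence makes the probability of a count vector a product over the cells. Only the factor
    of cell j changes, and [poisson_weightS] absorbs the multiplicity q_j + 1. *)
Let campbell_col J (c : 'rV[R]_d -> J) (q : {ffun J -> nat}) j : coloring c ->
  campbell Pi [set p | col c p.1 = q /\ c p.2 = j] =
  ((m (c @^-1` [set j]))%:E * Pi [set X | col c X = q])%E.
Proof.
move=> mc; rewrite /campbell.
under eq_integral => X _.
  rewrite reduced_count_col natrM.
  rewrite (_ : (_ == _)%:R = \1_[set X | col c X = bump_col q j] X); last first.
    rewrite indicE; congr (_%:R); congr nat_of_bool.
    by apply/eqP/idP; rewrite inE.
  rewrite EFinM; over.
rewrite ge0_integralZl_EFin//; last first.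
  by apply/measurable_EFinP/measurable_indic; exact: measurable_col.
rewrite integral_indic//; last exact: measurable_col.
rewrite setIT [in RHS]poisson_col//.
transitivity (((q j).+1%:R)%:E *
    (\prod_i poisson_weight (m (c @^-1` [set i])) (bump_col q j i))%:E)%E.
  by congr (_ * _)%E; exact: poisson_col.
rewrite -!EFinM; congr EFin.
rewrite (bigD1 j)//= [in RHS](bigD1 j)//= ffunE eqxx addn1.
rewrite mulrA [X in X * _]mulrC poisson_weightS -mulrA; congr (_ * (_ * _)).
by apply: eq_bigr => i /negbTE ij; rewrite ffunE ij addn0.
Qed.


(** The pi-system for Mecke's formula. [Q] may be any set, since the pairs of a count vector and a
    color form a countable type. *)
Let partition_events : set (set (conf R d * 'rV[R]_d)) :=
  [set F | exists J (c : 'rV[R]_d -> J) (Q : set ({ffun J -> nat} * J)),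
    coloring c /\ F = [set p | Q (col c p.1, c p.2)]].

Let npoints_refine J (c : 'rV[R]_d -> J) B X :
  npoints B X = (\sum_j npoints (B `&` c @^-1` [set j]) X)%N.
Proof.
rewrite npointsE.
under [RHS]eq_bigr do rewrite npointsE.
rewrite exchange_big/=; apply: eq_bigr => y _.
rewrite (bigD1 (c y))//= [X in (_ + X)%N]big1 ?addn0 => [|j jc].
  by congr nat_of_bool; apply/idP/idP; rewrite !inE//; case.
by apply/eqP; rewrite eqb0; apply/negP; rewrite inE /= => -[_] cy; rewrite cy eqxx in jc.
Qed.

(** Two partitions have a common refinement, colored by pairs; the counts of either partition are
    row or column sums of the refined counts. *)
Let partition_eventsI : setI_closed partition_events.
Proof.
move=> _ _ [J [c [Q [mc ->]]]] [J' [c' [Q' [mc' ->]]]].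
exists (J * J')%type, (fun x => (c x, c' x)).
exists [set p : {ffun J * J' -> nat} * (J * J') | Q ([ffun j => \sum_j' p.1 (j, j')]%N, p.2.1) /\
                Q' ([ffun j' => \sum_j p.1 (j, j')]%N, p.2.2)].
have E j j' : (fun x => (c x, c' x)) @^-1` [set (j, j')] =
    c @^-1` [set j] `&` c' @^-1` [set j'].
  by apply/seteqP; split=> x /= [-> ->].
split; first by move=> [j j']; rewrite E; exact: measurableI.
have E1 X : [ffun j => \sum_j' (col (fun x => (c x, c' x)) X) (j, j')]%N = col c X.
  apply/ffunP => j; rewrite !ffunE (npoints_refine c').
  by apply: eq_bigr => j' _; rewrite ffunE E.
have E2 X : [ffun j' => \sum_j (col (fun x => (c x, c' x)) X) (j, j')]%N = col c' X.
  apply/ffunP => j'; rewrite !ffunE (npoints_refine c).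
  by apply: eq_bigr => j _; rewrite ffunE E setIC.
by apply/seteqP; split=> -[X x] /=; rewrite E1 E2.
Qed.

Let coloring_mem (B : set 'rV[R]_d) : measurable B -> coloring (fun x => x \in B).
Proof.
move=> mB [].
  by rewrite (_ : _ @^-1` _ = B)//; apply/seteqP; split=> x; [exact: set_mem|exact: mem_set].
rewrite (_ : _ @^-1` _ = ~` B); first exact: measurableC.
apply/seteqP; split=> x /=; first by move=> /negbT; rewrite notin_setE.
by move=> Bx; apply/negbTE; rewrite notin_setE.
Qed.

Let partition_eventsT : partition_events setT.
Proof.
exists bool, (fun x => x \in [set: 'rV[R]_d]), setT.
by split; [exact: coloring_mem|].
Qed.

Let partition_events_measurable F : partition_events F -> measurable F.
Proof.
move=> [J [c [Q [mc ->]]]].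
rewrite (_ : [set p | _] = \bigcup_n (if choice.unpickle n is Some qj then
   if qj \in Q then [set X | col c X = qj.1] `*` (c @^-1` [set qj.2]) else set0
   else set0)).
  apply: bigcupT_measurable => n; case: choice.unpickle => // -[q j].
  by case: ifPn => // _; apply: measurableX; [exact: measurable_col|exact: mc].
apply/seteqP; split=> -[X x] /=.
  move=> h; exists (choice.pickle (col c X, c x)) => //.
  by rewrite choice.pickleK mem_set.
move=> [n _]; case: choice.unpickle => // -[q j]; case: ifPn => // /set_mem Qqj [/= Xq xj].
by rewrite Xq xj.
Qed.

(** The two-color partitions into a Borel set and its complement already give the generating events
    of both factors. *)
Let sigma_partition_events : @measurable _ (conf R d * 'rV[R]_d)%type = <<s partition_events >>.
Proof.
apply/seteqP; split; last first.
  apply: smallest_sub; first exact: sigma_algebra_measurable.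
  exact: partition_events_measurable.
have sT : <<s partition_events >> setT by apply: sub_sigma_algebra; exact: partition_eventsT.
have sI A B : <<s partition_events >> A ->
    <<s partition_events >> B -> <<s partition_events >> (A `&` B).
  pose TT := g_sigma_algebraType partition_events.
  by move=> hA hB; exact: (@measurableI _ TT).
rewrite measurable_prod_measurableType; apply: smallest_sub.
  exact: smallest_sigma_algebra.
move=> _ [A mA [B mB <-]].
rewrite (_ : A `*` B = (fst @^-1` A) `&` (snd @^-1` B))//.
apply: sI; last first.
  apply: sub_sigma_algebra; exists bool, (fun x => x \in B), [set p : {ffun bool -> nat} * bool | p.2].
  by split; [exact: coloring_mem|apply/seteqP; split=> -[X x] /=; rewrite inE].
move: A mA {B mB}; apply: smallest_sub.
  split.
  - by rewrite /= preimage_set0; exact: sigma_algebra0.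
  - by move=> A /= hA; rewrite setTD preimage_setC -setTD; exact: sigma_algebraCD.
  - by move=> A hA; rewrite /= preimage_bigcup; exact: sigma_algebra_bigcup.
move=> _ [[B k] /= mB <-]; apply: sub_sigma_algebra.
exists bool, (fun x => x \in B), [set p : {ffun bool -> nat} * bool | p.1 true = k].
split; first exact: coloring_mem.
apply/seteqP; split=> -[X x] /=; rewrite ffunE;
  by rewrite (_ : (fun x => _) @^-1` _ = B)//; apply/seteqP; split=> z; [exact: set_mem|exact: mem_set].
Qed.

(** Both sides are measures in [F]: the reduced Campbell measure, and the product of [Pi] with lam
    times Lebesgue measure on [T]. They agree on [partition_events], which contains the whole space,
    and the total mass is finite. *)
Theorem mecke F : measurable F ->
  campbell Pi F = (lam%:E * \int[Pi]_X lebesgue_rV (xsection F X `&` T))%E.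
Proof.
pose m0 : {measure set 'rV[R]_d -> \bar R} :=
  mscale (NngNum lam0) (mrestr (@lebesgue_rV R d) mT).
have m0E B : m0 B = (lam%:E * lebesgue_rV (B `&` T))%E by [].
have m0m B : measurable B -> m0 B = (m B)%:E.
  move=> mB; rewrite m0E /m EFinM fineK// ge0_fin_numE//.
  by apply: le_lt_trans T_lty; apply: le_measure; rewrite ?inE//; exact: measurableI.
have sm0 : sigma_finite setT m0.
  apply: fin_num_fun_sigma_finite; first by rewrite measure0.
  by move=> B mB; rewrite m0m.
have [m1 m1E] := sigma_finite_bundle sm0.
have CEp G : partition_events G -> campbell Pi G = (Pi \x m1)%E G.
  move=> PG; have mG := partition_events_measurable PG.
  case: PG mG => J [c [Q [mc ->]]] mG.
  (* The exact inverse [pickle_inv] lists every pair at one index only, which makes the pieces [u n]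
     disjoint. *)
  pose inv n : option ({ffun J -> nat} * J) := choice.pickle_inv n.
  pose u n : set (conf R d * 'rV[R]_d) :=
    if inv n is Some qj then
      if qj \in Q then [set p | col c p.1 = qj.1 /\ c p.2 = qj.2] else set0
    else set0.
  have uE : [set p | Q (col c p.1, c p.2)] = \bigcup_n u n.
    apply/seteqP; split=> -[X x] /=.
      move=> h; exists (choice.pickle (col c X, c x)) => //.
      by rewrite /u /inv choice.pickleK_inv mem_set.
    move=> [n _]; rewrite /u; case: (inv n) => // -[q j].
    by case: ifPn => // /set_mem Qqj [/= -> ->].
  have uX q j : [set p : conf R d * 'rV[R]_d | col c p.1 = q /\ c p.2 = j] =
      [set X | col c X = q] `*` (c @^-1` [set j]).
    by apply/seteqP; split=> -[X x].
  have mu' n : measurable (u n).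
    rewrite /u; case: (inv n) => // -[q j]; case: ifPn => // _.
    by rewrite uX; apply: measurableX; [exact: measurable_col|exact: mc].
  have tu : trivIset setT u.
    have un n X x : u n (X, x) -> n = choice.pickle (col c X, c x).
      rewrite /u => h; have := @choice.pickle_invK ({ffun J -> nat} * J)%type n.
      rewrite -/(inv n); move: h; case: (inv n) => // -[q j].
      by case: ifPn => // _ [/= -> ->] /= ->.
    by move=> n k _ _ [[X x] [/un -> /un ->]].
  rewrite uE !measure_bigcup//.
  apply: eq_eseriesr => n _; rewrite /u; case: (inv n) => [[q j]|].
    case: ifPn => _; last by rewrite !measure0.
    rewrite [LHS]campbell_col// uX [RHS]product_measure1E//; last exact: measurable_col.
    by rewrite m1E m0m// muleC.
  by rewrite !measure0.
have CE : forall F, measurable F -> campbell Pi F = (Pi \x m1)%E F.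
  apply: (measure_unique partition_events (fun=> setT)) => //.
  - by apply/seteqP; split=> // p _; exists 0%N.
  - move=> _; rewrite [ltLHS]CEp// -setXTT [ltLHS]product_measure1E//.
    have P1 : Pi setT = 1%E by exact: probability_setT.
    by rewrite [X in (X * _)%E]P1 mul1e m1E m0m// ltry.
move=> mF; rewrite CE// /product_measure1 -ge0_integralZl//.
- by apply: eq_integral => X _; rewrite /= m1E.
- have := @measurable_fun_xsection _ _ _ _ _ (@lebesgue_rV R d) (F `&` (setT `*` T)).
  rewrite (_ : _ \o _ = fun X => lebesgue_rV (xsection F X `&` T)); last first.
    by apply/funext => X /=; rewrite xsectionI in_xsectionX// in_setT.
  by apply; apply: measurableI => //; exact: measurableX.
Qed.

End mecke.
Lemma measurable_preimage (d1 d2 : measure_display) (T1 : measurableType d1)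
    (T2 : measurableType d2) (f : T1 -> T2) (A : set T2) :
  measurable_fun setT f -> measurable A -> measurable (f @^-1` A).
Proof. by move=> mf mA; rewrite -[X in measurable X]setTI; exact: mf. Qed.

(** * Contraction *)

Section bounded_integrals.
Context {dT : measure_display} {T : measurableType dT} {R : realType}.
Variables (m : {sigma_finite_measure set T -> \bar R}) (D : set T).
Hypotheses (mD : measurable D) (D_lty : (m D < +oo)%E).
Implicit Types (f g : T -> R) (E : set T).

(** On a set of finite measure such functions are integrable, so that integrals can be taken as real
    numbers from here on. *)
Definition bounded_measurable f :=
  measurable_fun setT f /\ exists M, forall x, `|f x| <= M.

Definition integral_on f : R := \int[m]_(x in D) f x.

Definition volume_in E : R := fine (m (E `&` D)).

Lemma bounded_measurable_cst k : bounded_measurable (cst k).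
Proof. by split; [exact: measurable_cst|exists `|k|]. Qed.

Lemma bounded_measurableD f g : bounded_measurable f -> bounded_measurable g ->
  bounded_measurable (fun x => f x + g x).
Proof.
move=> [mf [M fM]] [mg [N gN]]; split; first exact: measurable_funD.
by exists (M + N) => x; rewrite (le_trans (ler_normD _ _))// lerD.
Qed.

Lemma bounded_measurableM f g : bounded_measurable f -> bounded_measurable g ->
  bounded_measurable (fun x => f x * g x).
Proof.
move=> [mf [M fM]] [mg [N gN]]; split; first exact: measurable_funM.
by exists (M * N) => x; rewrite normrM ler_pM.
Qed.

Lemma bounded_measurableZ k f : bounded_measurable f ->
  bounded_measurable (fun x => k * f x).
Proof. by apply: bounded_measurableM; exact: bounded_measurable_cst. Qed.

Lemma bounded_measurable_indic E : measurable E -> bounded_measurable \1_E.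
Proof.
move=> mE; split; first exact: measurable_indic.
by exists 1 => x; rewrite indicE; case: (_ \in _); rewrite ?normr1 ?normr0.
Qed.

Lemma bounded_measurable_integrable f : bounded_measurable f ->
  m.-integrable D (EFin \o f).
Proof.
move=> [mf [M fM]]; apply: measurable_bounded_integrable => //.
  exact: measurable_funS mf.
by exists M; split; [exact: num_real|move=> N MN x _ /=; exact: le_trans (fM x) (ltW MN)].
Qed.

Lemma integral_onD f g : bounded_measurable f -> bounded_measurable g ->
  integral_on (fun x => f x + g x) = integral_on f + integral_on g.
Proof. by move=> *; rewrite /integral_on RintegralD//; exact: bounded_measurable_integrable. Qed.

Lemma integral_onZ k f : bounded_measurable f -> integral_on (fun x => k * f x) = k * integral_on f.
Proof. by move=> *; rewrite /integral_on RintegralZl//; exact: bounded_measurable_integrable. Qed.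

Lemma integral_on_cst k : integral_on (cst k) = k * volume_in setT.
Proof. by rewrite /integral_on Rintegral_cst// /volume_in setTI. Qed.

Lemma integral_on_indic E : measurable E -> integral_on \1_E = volume_in E.
Proof. by move=> mE; rewrite /integral_on /Rintegral integral_indic. Qed.

Lemma le_integral_on f g : bounded_measurable f -> bounded_measurable g ->
  (forall x, D x -> f x <= g x) -> integral_on f <= integral_on g.
Proof.
by move=> *; apply: le_Rintegral => //; exact: bounded_measurable_integrable.
Qed.

Lemma eq_integral_on f g : (forall x, D x -> f x = g x) -> integral_on f = integral_on g.
Proof. by move=> fg; apply: eq_Rintegral => x; rewrite inE; exact: fg. Qed.

Lemma integral_on_EFin f : bounded_measurable f ->
  (\int[m]_(x in D) (f x)%:E = (integral_on f)%:E)%E.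
Proof.
move=> bf; rewrite /integral_on /Rintegral fineK//.
exact: (integrable_fin_num mD (bounded_measurable_integrable bf)).
Qed.

Lemma volume_in_fin E : measurable E -> m (E `&` D) = (volume_in E)%:E.
Proof.
move=> mE; rewrite /volume_in fineK// ge0_fin_numE//.
by apply: le_lt_trans D_lty; apply: le_measure; rewrite ?inE//; exact: measurableI.
Qed.

Lemma volume_in_ge0 E : 0 <= volume_in E.
Proof. by rewrite /volume_in fine_ge0. Qed.

Lemma le_volume_in E E' : measurable E -> measurable E' -> E `<=` E' -> volume_in E <= volume_in E'.
Proof.
move=> mE mE' EE'; rewrite -lee_fin -!volume_in_fin//.
by apply: le_measure; rewrite ?inE; [exact: measurableI..|exact: setSI].
Qed.

Lemma volume_inU E E' : measurable E -> measurable E' -> [disjoint E & E'] ->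
  volume_in (E `|` E') = volume_in E + volume_in E'.
Proof.
move=> mE mE' /disj_setPS EE'; apply: EFin_inj.
rewrite EFinD -!volume_in_fin//; last exact: measurableU.
rewrite setIUl measureU//; [exact: measurableI..|].
by apply/seteqP; split=> // x [[Ex _] [E'x _]]; exact: (EE' x).
Qed.

Lemma volume_inD E E' : measurable E -> measurable E' -> E' `<=` E ->
  volume_in (E `\` E') = volume_in E - volume_in E'.
Proof.
move=> mE mE' EE'; apply/eqP; rewrite eq_sym subr_eq -volume_inU//.
- by rewrite setUC setDUK.
- exact: measurableD.
- by apply/disj_setPS => x [[]].
Qed.

Lemma volume_in_le E : measurable E -> volume_in E <= volume_in setT.
Proof. by move=> mE; exact: le_volume_in. Qed.

(** The conclusion spells out [bounded_measurable], which inside this section is fixed to functions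
    on [T] and not on [S]. *)
Lemma bounded_measurable_volume (dS : measure_display) (S : measurableType dS)
    (G : set (S * T)) : measurable G ->
  measurable_fun setT (fun s => volume_in (xsection G s)) /\
  exists M, forall s, `|volume_in (xsection G s)| <= M.
Proof.
move=> mG; split.
  have mGD : measurable (G `&` (setT `*` D)).
    by apply: measurableI => //; exact: measurableX.
  have mf := measurable_fun_xsection m mGD.
  rewrite (_ : (fun s => _) = fine \o (m \o xsection (G `&` (setT `*` D)))).
    by apply: measurableT_comp => //; exact: measurable_fine.
  apply/funext => s /=; rewrite /volume_in; congr (fine (m _)).
  by rewrite xsectionI in_xsectionX// in_setT.
exists (volume_in setT) => s; rewrite ger0_norm ?volume_in_ge0// volume_in_le//.
exact: measurable_xsection.
Qed.

Lemma bounded_measurable_volume_ysection (G : set (T * T)) : measurable G ->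
  bounded_measurable (fun y => volume_in (ysection G y)).
Proof.
move=> mG; have mG' := measurable_preimage (@measurable_swap _ _ T T) mG.
rewrite (_ : (fun y => _) = (fun y => volume_in (xsection (@unstable.swap T T @^-1` G) y))).
  exact: bounded_measurable_volume.
apply/funext => y; congr volume_in; apply/seteqP; split=> x;
  by rewrite /xsection /ysection /= !inE.
Qed.

(** Fubini for the part of [G] inside [D]*[D], whose two iterated measures coincide. *)
Lemma integral_on_volume_swap (G : set (T * T)) : measurable G ->
  integral_on (fun x => volume_in (xsection G x)) = integral_on (fun y => volume_in (ysection G y)).
Proof.
move=> mG; pose G' := G `&` (D `*` D).
have mG' : measurable G' by apply: measurableI => //; exact: measurableX.
have : (m \x m)%E G' = (m \x^ m)%E G'.
  by apply: product_measure_unique => // A B mA mB; exact: product_measure2E.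
rewrite /product_measure1 /product_measure2 => h; rewrite /integral_on /Rintegral; congr fine.
rewrite [LHS]integral_mkcond [RHS]integral_mkcond.
rewrite [LHS](_ : _ = \int[m]_x (m \o xsection G') x)%E; last first.
  apply: eq_integral => x _; rewrite patchE /=; case: ifPn => xD.
    by rewrite -volume_in_fin; [rewrite xsectionI in_xsectionX|exact: measurable_xsection].
  by rewrite xsectionI notin_xsectionX// setI0 measure0.
rewrite h; apply: eq_integral => y _; rewrite patchE /=; case: ifPn => yD.
  by rewrite -volume_in_fin; [rewrite ysectionI in_ysectionX|exact: measurable_ysection].
by rewrite ysectionI notin_ysectionX// setI0 measure0.
Qed.

End bounded_integrals.

(** * The chain on all finite configurations *)

Section extended_dynamics.
Context {R : realType} {d : nat}.
Variables (r lam : R) (Lam T : set 'rV[R]_d).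
Hypotheses (r_gt0 : 0 < r) (lam_gt0 : 0 < lam) (mLam : measurable Lam)
  (Lam_lty : (lebesgue_rV Lam < +oo)%E) (mT : measurable T).
Implicit Types (X : conf R d) (x y v : 'rV[R]_d) (f : conf R d -> R).

Local Notation vol := (volume_in (@lebesgue_rV R d) Lam).
Local Notation integ := (integral_on (@lebesgue_rV R d) Lam).
Local Notation n := (vol setT).

Definition insert X x : conf R d :=
  if x \in free r T X then (x |` X)%fset else X.

Lemma measurable_insert_free :
  measurable_fun setT (fun p : conf R d * 'rV[R]_d => insert p.1 p.2).
Proof.
have -> : (fun p => insert p.1 p.2) = (fun p =>
    if p \in [set p : conf R d * 'rV[R]_d | free r T p.1 p.2]
    then (p.2 |` p.1)%fset else p.1).
  by apply/funext => p; rewrite /insert; congr (if _ then _ else _).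
apply: measurable_fun_ifT; [|exact: measurable_insert|exact: measurable_fst].
apply: (@measurable_fun_bool _ _ _ _ true).
by rewrite setTI preimage_mem_true; exact: measurable_free2.
Qed.

(** The class of test functions: it contains the indicators of events and is preserved by the
    transition operator. *)
Definition unit_fun f := measurable_fun setT f /\ forall X, 0 <= f X <= 1.

(* On hard-core configurations this is the kernel of the single-center dynamics
   acting on f; elsewhere [insert] ignores the overlaps already present in X. *)
Definition transition f X : R := (n * (1 + lam))^-1 *
  (integ (fun x => f (remove_ball r X x)) + lam * integ (fun x => f (insert X x))).

Lemma bounded_measurable_remove f X : unit_fun f ->
  bounded_measurable (fun x => f (remove_ball r X x)).
Proof.
move=> [mf f01]; split.
  apply: (measurableT_comp mf).
  exact: (measurable_fun_pair2 (f := fun p => remove_ball r p.1 p.2) X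
    (measurable_remove_ball r)).
by exists 1 => x; have /andP[? ?] := f01 (remove_ball r X x); rewrite ger0_norm.
Qed.

Lemma bounded_measurable_insert f X : unit_fun f ->
  bounded_measurable (fun x => f (insert X x)).
Proof.
move=> [mf f01]; split.
  apply: (measurableT_comp mf).
  exact: (measurable_fun_pair2 (f := fun p => insert p.1 p.2) X
    measurable_insert_free).
by exists 1 => x; have /andP[? ?] := f01 (insert X x); rewrite ger0_norm.
Qed.

Lemma measurable_integral_on (g : conf R d * 'rV[R]_d -> conf R d) f :
  measurable_fun setT g -> unit_fun f ->
  measurable_fun setT (fun X => integ (fun x => f (g (X, x)))).
Proof.
move=> mg [mf f01].
pose h (p : conf R d * 'rV[R]_d) : \bar R := (f (g p) * \1_Lam p.2)%:E.
have mh : measurable_fun setT h.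
  apply/measurable_EFinP; apply: measurable_funM; first exact: measurableT_comp.
  by apply: measurableT_comp => //; exact: measurable_indic.
have h0 p : (0 <= h p)%E.
  by rewrite lee_fin mulr_ge0//; have /andP[] := f01 (g p).
have := measurable_fun_fubini_tonelli_F (m2 := @lebesgue_rV R d) h mh h0.
rewrite /fubini_F => mF.
rewrite (_ : (fun X => _) = fine \o (fun X => \int[@lebesgue_rV R d]_y h (X, y))%E).
  by apply: measurableT_comp => //; exact: measurable_fine.
apply/funext => X /=; rewrite /integral_on /Rintegral integral_mkcond; congr fine.
apply: eq_integral => x _; rewrite patchE /h /= indicE.
by case: ifPn => _; rewrite ?mulr1 ?mulr0.
Qed.

Lemma integral_on_unit_fun (g : 'rV[R]_d -> R) : bounded_measurable g ->
  (forall x, 0 <= g x <= 1) -> 0 <= integ g <= n.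
Proof.
move=> bg g01; apply/andP; split.
  by apply: Rintegral_ge0 => x _; have /andP[] := g01 x.
rewrite -[leRHS]mul1r -integral_on_cst//; apply: le_integral_on => //.
  exact: bounded_measurable_cst.
by move=> x _; have /andP[] := g01 x.
Qed.

Lemma unit_fun_transition f : unit_fun f -> unit_fun (transition f).
Proof.
move=> uf; split.
  apply: measurable_funM => //; apply: measurable_funD.
    exact: (measurable_integral_on (measurable_remove_ball r) uf).
  by apply: measurable_funM => //; exact: (measurable_integral_on measurable_insert_free uf).
move=> X; have [mf f01] := uf.
have /andP[a0 a1] := integral_on_unit_fun (bounded_measurable_remove X uf) (fun x => f01 _).
have /andP[b0 b1] := integral_on_unit_fun (bounded_measurable_insert X uf) (fun x => f01 _).
have n0 : 0 <= n by exact: volume_in_ge0.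
have nl : 0 <= n * (1 + lam) by rewrite mulr_ge0// addr_ge0// ltW.
apply/andP; split.
  by rewrite mulr_ge0 ?invr_ge0// addr_ge0// mulr_ge0// ltW.
(* If the volume is 0, the inverse takes its default value 0 and the operator is identically 0. *)
have [nl0|nl0] := eqVneq (n * (1 + lam)) 0.
  by rewrite /transition nl0 invr0 mul0r.
have {}nl0 : 0 < n * (1 + lam) by rewrite lt_neqAle eq_sym nl0.
rewrite /transition mulrC ler_pdivrMr// mul1r mulrDr mulr1 [n * lam]mulrC lerD//.
by rewrite ler_pM2l.
Qed.

(** * One-step contraction in the weighted metric *)

Section contraction.
Variables (c gam M : R).
Hypotheses (c_ge0 : 0 <= c) (gam_ge0 : 0 <= gam) (cM : c * M = 1 - gam)
  (lamE : lam = 2 * c) (lam_le1 : lam <= 1).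
Hypothesis n_gt0 : 0 < n.
Hypothesis vol_ball : forall v, T v -> vol (eball v r) = 1.
Hypothesis vol_ball2 : forall v, vol (eball v (2 * r)) <= M.

Definition weight X v : R := 1 + c * vol (free r T X `&` eball v (2 * r)).

(** The Lipschitz condition along the edges of the path metric. [X] ranges over all finite subsets
    of [T], overlapping ones included. *)
Definition lipschitz (L : R) f := forall X v, [set` X] `<=` T -> T v ->
  v \notin X -> `|f (v |` X)%fset - f X| <= L * weight X v.

Lemma measurable_free_ball X v : measurable (free r T X `&` eball v (2 * r)).
Proof. by apply: measurableI; [exact: measurable_free|exact: measurable_eball]. Qed.

Lemma weight_ge1 X v : 1 <= weight X v.
Proof. by rewrite lerDl mulr_ge0// volume_in_ge0. Qed.

Lemma weight_le2 X v : weight X v <= 2.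
Proof.
suff : c * vol (free r T X `&` eball v (2 * r)) <= 1 by rewrite /weight; lra.
apply: (@le_trans _ _ (c * M)); last by rewrite cM gerBl.
apply: ler_wpM2l => //; apply: le_trans (vol_ball2 v).
apply: le_volume_in => //; [exact: measurable_free_ball|exact: measurable_eball].
Qed.

Lemma free_setU1 X v : free r T (v |` X)%fset = free r T X `\` eball v (2 * r).
Proof.
apply/seteqP; split=> x [].
  move=> Tx h; split; first by split => // y yX; apply: h; rewrite !inE yX orbT.
  by rewrite /eball /= edistC ltNge h// !inE eqxx.
move=> [Tx h] /negP; rewrite -leNgt edistC => xv; split => // y.
by rewrite !inE => /orP[/eqP ->//|]; exact: h.
Qed.

Lemma free_notin X x : free r T X x -> x \notin X.
Proof.
move=> [_ h]; apply/negP => /h; rewrite edistxx leNgt.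
by rewrite mulr_gt0.
Qed.

Lemma remove_ball_sub X x : (remove_ball r X x `<=` X)%fset.
Proof. by apply/fsubsetP => y; rewrite !inE => /andP[]. Qed.

Lemma remove_ball_setU1 X x v : remove_ball r (v |` X)%fset x =
  if v \in eball x r then remove_ball r X x else (v |` remove_ball r X x)%fset.
Proof.
apply/fsetP => y; case: ifPn => vx; rewrite !inE /=.
  by have [->|] := eqVneq y v; rewrite //= vx andbF.
by have [->|] := eqVneq y v; rewrite //= vx.
Qed.

Section one_step.
Variables (X : conf R d) (v : 'rV[R]_d) (f : conf R d -> R) (L : R).
Hypotheses (XT : [set` X] `<=` T) (Tv : T v) (vX : v \notin X)
  (uf : unit_fun f) (L0 : 0 <= L) (fL : lipschitz L f).

Let Y : conf R d := (v |` X)%fset.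
Let D := free r T X `&` eball v (2 * r).
Let FY := free r T Y.
Let u := vol D.

Let mD : measurable D. Proof. exact: measurable_free_ball. Qed.
Let mFY : measurable FY. Proof. exact: measurable_free. Qed.

(** Pairs of a deletion point that spares v and a point of B_2r(v) that is free after the deletion;
    the section at x has the new value of u as its volume. *)
Let G1 : set ('rV[R]_d * 'rV[R]_d) := [set p | ~ eball v r p.1 /\
  free r T (remove_ball r X p.1) p.2 /\ eball v (2 * r) p.2].

(** The weight of the pair after a deletion at x. It vanishes when v is deleted, since the section
    of [G1] is then empty as well. *)
Let psi1 x := \1_(~` eball v r) x + c * vol (xsection G1 x).

Let mG1 : measurable G1.
Proof.
apply: measurableI.
  apply: (measurable_preimage (A := ~` eball v r) measurable_fst).
  by apply: measurableC; exact: measurable_eball.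
apply: measurableI; last first.
  exact: (measurable_preimage measurable_snd (measurable_eball v (2 * r))).
have mg : measurable_fun setT (fun p : 'rV[R]_d * 'rV[R]_d => (remove_ball r X p.1, p.2)).
  apply: measurable_fun_pair; last exact: measurable_snd.
  apply: measurableT_comp; last exact: measurable_fst.
  exact: (measurable_fun_pair2 (f := fun p => remove_ball r p.1 p.2) X
    (measurable_remove_ball r)).
by have := mg measurableT _ (measurable_free2 r mT); rewrite setTI.
Qed.

Let removal_diff x : `|f (remove_ball r Y x) - f (remove_ball r X x)| <= L * psi1 x.
Proof.
rewrite remove_ball_setU1; case: ifPn => vx.
  by rewrite subrr normr0 mulr_ge0// addr_ge0// mulr_ge0// volume_in_ge0.
have nvx : (~` eball v r) x.
  by move: vx; rewrite notin_setE /eball /= edistC.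
have -> : psi1 x = weight (remove_ball r X x) v.
  rewrite /psi1 /weight indicE mem_set//; congr (_ + _ * vol _).
  apply/seteqP; split=> y; rewrite /xsection /= inE /G1 /=; first by case.
  by case.
apply: fL => //.
  by move=> y /= /(fsubsetP (remove_ball_sub X x)); exact: XT.
by apply: contra vX => /(fsubsetP (remove_ball_sub X x)).
Qed.

Let bpsi1 : bounded_measurable psi1.
Proof.
apply: bounded_measurableD.
  by apply: bounded_measurable_indic; apply: measurableC; exact: measurable_eball.
apply: bounded_measurableZ; exact: bounded_measurable_volume.
Qed.

Let integ_psi1 : integ psi1 <= (n - 1) + c * ((n - 1) * u + (M - u)).
Proof.
have mB w l : measurable (eball w l : set 'rV[R]_d) by exact: measurable_eball.
have mBD : measurable (eball v (2 * r) `\` D) by exact: measurableD.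
have bsec : bounded_measurable (fun x => vol (xsection G1 x)).
  exact: bounded_measurable_volume.
rewrite /psi1 integral_onD//; last 2 first.
- by apply: bounded_measurable_indic; apply: measurableC.
- exact: bounded_measurableZ.
have volC : vol (~` eball v r) = n - 1.
  by rewrite -setTD volume_inD// vol_ball.
rewrite integral_onZ// integral_on_indic//; last exact: measurableC.
rewrite volC lerD2l ler_wpM2l// integral_on_volume_swap//.
(* After the exchange of integrals y is fixed and the deletion points x are measured. For y in [D]
   they lie outside B_r(v), a set of volume n - 1; for y elsewhere in B_2r(v) their volume is at
   most 1. *)
apply: (@le_trans _ _ (integ (fun y => (n - 1) * \1_D y + \1_(eball v (2 * r) `\` D) y))).
  apply: le_integral_on => //.
  - exact: bounded_measurable_volume_ysection.
  - by apply: bounded_measurableD; [apply: bounded_measurableZ|]; exact: bounded_measurable_indic.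
  move=> y _; rewrite !indicE.
  have mys : measurable (ysection G1 y) by exact: measurable_ysection.
  have [yD|yD] := boolP (y \in D).
    rewrite mulr1 memNset ?addr0; last by case; move/set_mem: yD.
    rewrite -volC; apply: le_volume_in => //; first exact: measurableC.
    by move=> x; rewrite /ysection /= inE => -[].
  rewrite mulr0 add0r; have [yB|yB] := boolP (y \in _).
    (* If a center w blocks y, only deletion points in B_r(w) can free y, and that ball has volume
       1. If none does, y lies outside [T] and is never free. *)
    case: (pselect (exists2 w, w \in X & edist y w < 2 * r)) => [[w wX yw]|h].
      rewrite -(vol_ball (XT wX)); apply: le_volume_in => //.
      move=> x; rewrite /ysection /= inE => -[_ [/= [_ h] _]].
      rewrite /eball /= edistC ltNge; apply/negP => xw.
      have := h w; rewrite leNgt yw => /(_ _)/negP; apply => //.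
      by rewrite !inE wX /= /eball /= notin_setE /=; apply/negP; rewrite -leNgt.
    rewrite (_ : ysection G1 y = set0) ?measure0//.
      by rewrite /volume_in set0I measure0.
    apply/seteqP; split=> x //; rewrite /ysection /= inE => -[_ [/= [Ty _] yv]].
    move: yD; rewrite notin_setE; apply; split => //; split => // w wX.
    by rewrite leNgt; apply/negP => yw; apply: h; exists w.
  rewrite (_ : ysection G1 y = set0) ?measure0//.
    by rewrite /volume_in set0I measure0.
  apply/seteqP; split=> x //; rewrite /ysection /= inE => -[_ [/= Fy yv]].
  by move: yB; rewrite notin_setE; apply; split => //; move/negP: yD; rewrite inE.
rewrite integral_onD//; last 2 first.
- by apply: bounded_measurableZ; exact: bounded_measurable_indic.
- exact: bounded_measurable_indic.
rewrite integral_onZ//; last exact: bounded_measurable_indic.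
rewrite !integral_on_indic// lerD2l volume_inD// ?lerD2r//.
by move=> y [].
Qed.

(** [G2] and [G3] are transposes of each other. A section of [G2] at x in [D] gives the extra weight
    of (X + v, x); a section of [G3] at x in F(X + v) is the part of [D] that x blocks. *)
Let G2 : set ('rV[R]_d * 'rV[R]_d) :=
  [set p | D p.1 /\ FY p.2 /\ edist p.1 p.2 < 2 * r].
Let G3 : set ('rV[R]_d * 'rV[R]_d) :=
  [set p | FY p.1 /\ D p.2 /\ edist p.1 p.2 < 2 * r].

Let mG2 : measurable G2.
Proof.
apply: measurableI; first exact: (measurable_preimage measurable_fst mD).
apply: measurableI; first exact: (measurable_preimage measurable_snd mFY).
exact: measurable_edist_lt.
Qed.

Let mG3 : measurable G3.
Proof.
apply: measurableI; first exact: (measurable_preimage measurable_fst mFY).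
apply: measurableI; first exact: (measurable_preimage measurable_snd mD).
exact: measurable_edist_lt.
Qed.

(** The old weight, plus the weight of (X + v, x) for x in [D], minus what is gained when x is
    inserted in both chains. *)
Let psi2 x := weight X v + (\1_D x + c * (vol (xsection G2 x) - vol (xsection G3 x))).

Let notin_xsection (G : set ('rV[R]_d * 'rV[R]_d)) x :
  (forall y, ~ G (x, y)) -> vol (xsection G x) = 0.
Proof.
move=> h; rewrite (_ : xsection G x = set0) /volume_in ?set0I ?measure0//.
by apply/seteqP; split=> y //; rewrite /xsection /= inE => /h.
Qed.

Let FYE : FY = free r T X `\` eball v (2 * r).
Proof. exact: free_setU1. Qed.

(* On D the three configurations X + x, X + x + v, X + v are compared in turn. *)
Let insertion_diff x : `|f (insert Y x) - f (insert X x)| <= L * psi2 x.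
Proof.
have insT (Z : conf R d) : free r T Z x -> insert Z x = (x |` Z)%fset.
  by move=> h; rewrite /insert mem_set.
have insF (Z : conf R d) : ~ free r T Z x -> insert Z x = Z.
  by move=> h; rewrite /insert memNset.
have XxT : T x -> [set` (x |` X)%fset] `<=` T.
  by move=> Tx y /=; rewrite !inE => /orP[/eqP ->//|]; exact: XT.
have YT : [set` Y] `<=` T.
  by move=> y /=; rewrite !inE => /orP[/eqP ->//|]; exact: XT.
(* Three cases: x is not free for X and neither chain moves; x lies in [D] and only the chain at X
   moves; x is free for X + v and both move. *)
case: (pselect (free r T X x)) => [FXx|FXx]; last first.
  have FYx : ~ FY x by rewrite FYE => -[].
  rewrite !insF// /psi2 !notin_xsection ?subr0 ?mulr0 ?addr0; last 2 first.
  - by move=> y [].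
  - by move=> y [[]].
  by rewrite indicE memNset ?addr0; [exact: fL|case].
have [Tx _] := FXx; have xX := free_notin FXx.
case: (pselect (eball v (2 * r) x)) => xv.
  have Dx : D x by split.
  have FYx : ~ FY x by rewrite FYE => -[].
  rewrite [insert Y x]insF// insT// /psi2 [vol (xsection G3 x)]notin_xsection; last by move=> y [].
  rewrite indicE mem_set// subr0.
  have -> : xsection G2 x = free r T Y `&` eball x (2 * r).
    apply/seteqP; split=> y; rewrite /xsection /= inE /G2 /=; first by case.
    by case.
  rewrite -/(weight Y x).
  (* Inserting v itself makes the two chains meet. *)
  have [->|xnv] := eqVneq x v.
    by rewrite subrr normr0 mulr_ge0// addr_ge0// (le_trans ler01)// weight_ge1.
  have xY : x \notin Y by rewrite !inE negb_or xnv.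
  have vXx : v \notin (x |` X)%fset by rewrite !inE negb_or eq_sym xnv.
  have h1 := fL (XxT Tx) Tv vXx; have h2 := fL YT Tx xY.
  rewrite [(v |` (x |` X))%fset]fsetUCA -/Y in h1.
  (* An additional center can only shrink the free set. *)
  have w1 : weight (x |` X)%fset v <= weight X v.
    rewrite lerD2l ler_wpM2l// le_volume_in//.
      exact: measurable_free_ball.
    by apply: setSI; rewrite free_setU1; exact: subDsetl.
  have -> : f Y - f (x |` X)%fset =
      (f (x |` Y)%fset - f (x |` X)%fset) - (f (x |` Y)%fset - f Y) by lra.
  apply: le_trans (ler_normB _ _) _.
  by rewrite mulrDr lerD// (le_trans h1)// ler_wpM2l.
have FYx : FY x by rewrite FYE.
rewrite !insT// fsetUCA.
have xnv : x != v by apply/eqP => xv'; apply: xv; rewrite xv' /eball /= edistxx mulr_gt0.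
have vXx : v \notin (x |` X)%fset by rewrite !inE negb_or eq_sym xnv.
apply: le_trans (fL (XxT Tx) Tv vXx) _; rewrite ler_wpM2l//.
rewrite /psi2 indicE memNset; last by case.
rewrite [vol (xsection G2 x)]notin_xsection; last by move=> y [[]].
rewrite add0r sub0r /weight free_setU1 -addrA lerD2l -mulrDr ler_wpM2l//.
have -> : xsection G3 x = D `&` eball x (2 * r).
  apply/seteqP; split=> y; rewrite /xsection /= inE /G3 /=; first by case.
  by case.
have mDx : measurable (D `&` eball x (2 * r)).
  by apply: measurableI => //; exact: measurable_eball.
rewrite -volume_inD//.
apply: le_volume_in => //.
- apply: measurableI; last exact: measurable_eball.
  by apply: measurableD; [exact: measurable_free|exact: measurable_eball].
- exact: measurableD.
- by move=> y [[Fy nyx] yv]; split; [split|case].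
Qed.

Let bpsi2 : bounded_measurable psi2.
Proof.
apply: bounded_measurableD; first exact: bounded_measurable_cst.
apply: bounded_measurableD; first exact: bounded_measurable_indic.
apply: bounded_measurableZ; apply: bounded_measurableD.
  exact: bounded_measurable_volume.
rewrite (_ : (fun x => _) = (fun x => (-1) * vol (xsection G3 x))).
  by apply: bounded_measurableZ; exact: bounded_measurable_volume.
by apply/funext => x; rewrite mulN1r.
Qed.

(** By Fubini the integrals of the sections of [G2] and [G3] are equal and cancel. What remains is
    the old weight over volume n and the volume u of [D]. *)
Let integ_psi2 : integ psi2 = n * weight X v + u.
Proof.
have b2 : bounded_measurable (fun x => vol (xsection G2 x)) by exact: bounded_measurable_volume.
have b3 : bounded_measurable (fun x => vol (xsection G3 x)) by exact: bounded_measurable_volume.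
have b3' : bounded_measurable (fun x => (-1) * vol (xsection G3 x)).
  exact: bounded_measurableZ.
have bD : bounded_measurable (\1_D : _ -> R) by exact: bounded_measurable_indic.
rewrite /psi2 (_ : (fun x => _) = (fun x => cst (weight X v) x + (\1_D x +
    c * (vol (xsection G2 x) + (-1) * vol (xsection G3 x))))); last first.
  by apply/funext => x; rewrite mulN1r.
have b23 := bounded_measurableD b2 b3'.
have bc23 := bounded_measurableZ c b23.
rewrite integral_onD//; [|exact: bounded_measurable_cst|exact: bounded_measurableD].
have -> : integ (cst (weight X v)) = weight X v * n by exact: integral_on_cst.
rewrite integral_onD// integral_on_indic// integral_onZ// integral_onD// integral_onZ//.
rewrite integral_on_volume_swap//.
have -> : (fun y => vol (ysection G2 y)) = (fun x => vol (xsection G3 x)).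
  apply/funext => y; congr vol; apply/seteqP; split=> x;
    by rewrite /xsection /ysection /= !inE /G2 /G3 /= edistC => -[? []].
by rewrite mulN1r subrr mulr0 addr0 mulrC.
Qed.

Lemma transition_diff : `|transition f Y - transition f X| <= L * (1 - gam / (4 * n)) * weight X v.
Proof.
have nl : 0 < n * (1 + lam) by rewrite mulr_gt0// addr_gt0.
pose a Z x := f (remove_ball r Z x); pose b Z x := f (insert Z x).
have ba Z : bounded_measurable (a Z) by exact: bounded_measurable_remove.
have bb Z : bounded_measurable (b Z) by exact: bounded_measurable_insert.
have main g h (psi : 'rV[R]_d -> R) : bounded_measurable g -> bounded_measurable h ->
    bounded_measurable psi -> (forall x, `|g x - h x| <= L * psi x) ->
    `|integ g - integ h| <= L * integ psi.
  move=> bg bh bpsi gh; rewrite -integral_onZ// ler_distl; apply/andP; split.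
    rewrite lerBlDr -integral_onD//; last exact: bounded_measurableZ.
    apply: le_integral_on => //.
      by apply: bounded_measurableD => //; exact: bounded_measurableZ.
    by move=> x _; have := gh x; rewrite ler_distl => /andP[]; lra.
  rewrite -integral_onD//; last exact: bounded_measurableZ.
  apply: le_integral_on => //.
    by apply: bounded_measurableD => //; exact: bounded_measurableZ.
  by move=> x _; have := gh x; rewrite ler_distl => /andP[]; lra.
have h1 := main _ _ _ (ba Y) (ba X) bpsi1 removal_diff.
have h2 := main _ _ _ (bb Y) (bb X) bpsi2 insertion_diff.
rewrite integ_psi2 in h2.
have h3 : `|integ (a Y) - integ (a X)| <=
    L * ((n - 1) + c * ((n - 1) * u + (M - u))).
  by apply: le_trans h1 _; rewrite ler_wpM2l.
have w2 := weight_le2 X v; have w1 := weight_ge1 X v.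
have wE : weight X v = 1 + c * u by [].
rewrite /transition -/(a Y) -/(a X) -/(b Y) -/(b X) -mulrBr normrM ger0_norm ?invr_ge0 ?(ltW nl)//.
rewrite mulrC ler_pdivrMr//.
have -> : integ (a Y) + lam * integ (b Y) - (integ (a X) + lam * integ (b X)) =
  (integ (a Y) - integ (a X)) + lam * (integ (b Y) - integ (b X)) by lra.
apply: le_trans (ler_normD _ _) _.
rewrite normrM (gtr0_norm lam_gt0).
have h4 : lam * `|integ (b Y) - integ (b X)| <= lam * (L * (n * weight X v + u)).
  by rewrite ler_pM2l.
apply: le_trans (lerD h3 h4) _.
(* With w = 1 + c u, lam = 2 c and c M = 1 - gam all terms in u cancel outside n (1 + lam) w,
   leaving the additive drop gam. *)
have -> : L * (n - 1 + c * ((n - 1) * u + (M - u))) + lam * (L * (n * weight X v + u)) =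
    L * (n * (1 + lam) * weight X v - gam).
  have cML : L * (c * M) = L * (1 - gam) by rewrite cM.
  by rewrite wE lamE; move: cML; lra.
rewrite -!mulrA ler_wpM2l//.
have -> : (1 - gam / (4 * n)) * (weight X v * (n * (1 + lam))) =
   n * (1 + lam) * weight X v - gam * (weight X v * (1 + lam)) / 4.
  rewrite mulrBl mul1r; congr (_ - _); first by lra.
  rewrite invfM; transitivity (gam * (weight X v * (1 + lam)) / 4 * (n^-1 * n)); first by lra.
  by rewrite mulVf ?mulr1// gt_eqF.
(* The 4 in the rate: w <= 2 and 1 + lam <= 2 turn the additive drop into a factor. *)
have : gam * (weight X v * (1 + lam)) <= gam * 4.
  rewrite ler_wpM2l// (_ : 4 = 2 * 2)//; last by lra.
  by rewrite ler_pM//; have := lam_gt0; have := lam_le1; lra.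
by lra.
Qed.

End one_step.

Theorem lipschitz_transition L f : 0 <= L -> unit_fun f -> lipschitz L f ->
  lipschitz (L * (1 - gam / (4 * n))) (transition f).
Proof. by move=> L0 uf fL X v XT Tv vX; exact: transition_diff. Qed.

End contraction.
End extended_dynamics.
(** * Stationarity of the hard sphere measure *)

Section hard_core_configurations.
Context {R : realType} {d : nat}.
Variables (r lam : R) (Lam T : set 'rV[R]_d).
Hypotheses (r_gt0 : 0 < r) (lam_gt0 : 0 < lam) (mLam : measurable Lam)
  (Lam_lty : (lebesgue_rV Lam < +oo)%E) (mT : measurable T).
Hypothesis vol_ball : forall v, T v ->
  volume_in (@lebesgue_rV R d) Lam (eball v r) = 1.
Implicit Types (X : conf R d) (x y v : 'rV[R]_d) (f : conf R d -> R).

Local Notation vol := (volume_in (@lebesgue_rV R d) Lam).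
Local Notation integ := (integral_on (@lebesgue_rV R d) Lam).
Local Notation n := (vol setT).

(** [Omega] for an arbitrary set [T] of centers; the two are convertible when [T] is
    [allowed r Lam tau]. *)
Definition hard_spheres : set (conf R d) :=
  [set X | [set` X] `<=` T /\ hard_core r X].

Lemma hard_spheres_setU1 X x : x \notin X ->
  hard_spheres (x |` X)%fset <-> hard_spheres X /\ free r T X x.
Proof.
move=> xX; split.
  move=> [XT hX]; split; first split.
  - by move=> y /= yX; apply: XT; rewrite /= !inE yX orbT.
  - by move=> y z yX zX yz; apply: hX; rewrite ?inE ?yX ?zX ?orbT.
  - split; first by apply: XT; rewrite /= !inE eqxx.
    move=> y yX; apply: hX; rewrite ?inE ?eqxx ?yX ?orbT//.
    by apply: contraNneq xX => ->.
move=> [[XT hX] [Tx xf]]; split.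
  by move=> y /=; rewrite !inE => /orP[/eqP ->//|]; exact: XT.
move=> y z; rewrite !inE => /orP[/eqP ->|yX] /orP[/eqP ->|zX] yz.
- by rewrite eqxx in yz.
- exact: xf.
- by rewrite edistC; exact: xf.
- exact: hX.
Qed.

Lemma hard_spheres_setD1 X y : y \in X ->
  hard_spheres X <-> hard_spheres (X `\ y)%fset /\ free r T (X `\ y)%fset y.
Proof.
move=> yX; rewrite -{1}(fsetD1K yX); apply: hard_spheres_setU1.
by rewrite !inE eqxx.
Qed.

Lemma hard_spheres_sub X X' : (X' `<=` X)%fset -> hard_spheres X -> hard_spheres X'.
Proof.
move=> /fsubsetP X'X [XT hX]; split; first by move=> y /= /X'X; exact: XT.
by move=> y z /X'X yX /X'X zX; exact: hX.
Qed.

Lemma hard_spheres_insert X x : hard_spheres X -> hard_spheres (insert r T X x).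
Proof.
rewrite /insert; case: ifPn => // /set_mem xf hX.
by apply/hard_spheres_setU1; rewrite ?(free_notin r_gt0 xf).
Qed.

Lemma hard_spheres_ball_unique X x y z : hard_spheres X -> y \in X -> z \in X ->
  eball y r x -> eball z r x -> y = z.
Proof.
move=> [_ hX] yX zX yx zx; apply/eqP; apply/negP => /negP /(hX _ _ yX zX).
apply/negP; rewrite -ltNge; apply: le_lt_trans (edist_triangle x y z) _.
by rewrite mulr_natl mulr2n ltrD// edistC.
Qed.

Lemma sum_ball_hard_spheres X x (h : 'rV[R]_d -> R) : hard_spheres X ->
  \sum_(y <- enum_fset X) \1_(eball y r) x * h y =
  if [pick y : X | x \in eball (val y) r] is Some y then h (val y) else 0.
Proof.
move=> hX; case: pickP => [[y yX] /= /set_mem xy|h0].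
  rewrite (big_fsetD1 y)//= indicE mem_set// mul1r big_seq big1 ?addr0// => z.
  rewrite !inE => /andP[zy zX]; rewrite indicE memNset ?mul0r// => xz.
  by move/eqP: zy; apply; exact: (hard_spheres_ball_unique hX zX yX xz xy).
rewrite big_seq big1// => y yX; rewrite indicE.
by have /= := h0 [` yX]%fset; rewrite /= => ->; rewrite mul0r.
Qed.

Lemma integral_on_sum (I : Type) (s : seq I) (F : I -> 'rV[R]_d -> R) :
  (forall i, bounded_measurable (F i)) ->
  bounded_measurable (fun x => \sum_(i <- s) F i x) /\
  integ (fun x => \sum_(i <- s) F i x) = \sum_(i <- s) integ (F i).
Proof.
move=> bF; elim: s => [|i s [IH1 IH2]].
  rewrite big_nil (_ : (fun x => _) = cst 0); last by apply/funext => x; rewrite big_nil.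
  by split; [exact: bounded_measurable_cst|rewrite integral_on_cst// mul0r].
rewrite (_ : (fun x => _) = (fun x => F i x + \sum_(j <- s) F j x)); last first.
  by apply/funext => x; rewrite big_cons.
by split; [exact: bounded_measurableD|rewrite integral_onD// big_cons IH2].
Qed.

(** Each ball of radius r about a point of [T] has volume 1 inside [Lam]. *)
Lemma integral_on_sum_ball X (h : 'rV[R]_d -> R) : [set` X] `<=` T ->
  bounded_measurable (fun x => \sum_(y <- enum_fset X) \1_(eball y r) x * h y) /\
  integ (fun x => \sum_(y <- enum_fset X) \1_(eball y r) x * h y) =
  \sum_(y <- enum_fset X) h y.
Proof.
move=> XT; pose F (y x : 'rV[R]_d) := h y * \1_(eball y r) x.
have bF y : bounded_measurable (F y).
  by apply: bounded_measurableZ; apply: bounded_measurable_indic; exact: measurable_eball.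
have -> : (fun x => \sum_(y <- enum_fset X) \1_(eball y r) x * h y) =
  (fun x => \sum_(y <- enum_fset X) F y x).
  by apply/funext => x; apply: eq_bigr => y _; rewrite mulrC.
have [b1 ->] := integral_on_sum (enum_fset X) bF; split => //.
rewrite big_seq [RHS]big_seq; apply: eq_bigr => y yX.
rewrite /F integral_onZ//; last by apply: bounded_measurable_indic; exact: measurable_eball.
by rewrite integral_on_indic ?vol_ball ?mulr1//; [exact: XT|exact: measurable_eball].
Qed.

(** The balls about the centers are disjoint, so the sum of their indicators is at most 1.
    Integrating over [Lam] counts each center once. *)
Lemma card_hard_spheres X : hard_spheres X -> #|` X|%:R <= n.
Proof.
move=> hX; have [b1 e1] := integral_on_sum_ball (fun=> 1) hX.1.
have -> : #|` X|%:R = \sum_(y <- enum_fset X) 1 :> R.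
  by rewrite big_const_seq count_predT iter_addr addr0.
rewrite -e1 -[leRHS]mul1r -integral_on_cst//; apply: le_integral_on => //.
  exact: bounded_measurable_cst.
move=> x _; rewrite (@sum_ball_hard_spheres X x (fun=> 1))//.
by case: pickP.
Qed.

(* At most one y in X has x in its ball. The two sums are added on both sides so
   that no subtraction of functions is needed. *)
Lemma remove_ball_sum X x f : hard_spheres X ->
  f (remove_ball r X x) + \sum_(y <- enum_fset X) \1_(eball y r) x * f X =
  f X + \sum_(y <- enum_fset X) \1_(eball y r) x * f (X `\ y)%fset.
Proof.
move=> hX; rewrite (sum_ball_hard_spheres x (fun=> f X) hX).
rewrite (sum_ball_hard_spheres x (fun y => f (X `\ y)%fset) hX).
case: pickP => [[y yX] /= /set_mem xy|h0].
  rewrite addrC; congr (_ + f _); apply/fsetP => z; rewrite !inE /=.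
  have [zX|zX] := boolP (z \in X); last by rewrite andbF.
  rewrite andbT /=; have [->|zy] := eqVneq z y.
    by rewrite mem_set// /eball /= edistC.
  apply/negP => /set_mem; rewrite /eball /= edistC => xz.
  by move/eqP: zy; apply; exact: (hard_spheres_ball_unique hX zX yX xz xy).
rewrite !addr0; congr f; apply/fsetP => z; rewrite !inE /=.
have [zX|//] := boolP (z \in X); rewrite /=.
have /= := h0 [` zX]%fset => /negbT; rewrite !notin_setE /eball /= edistC.
by move=> h; apply/negP => /set_mem.
Qed.

(** [remove_ball_sum] is integrated: the deletion points that remove a given center have volume
    exactly 1. *)
Lemma integral_on_remove_ball X f : unit_fun f -> hard_spheres X ->
  integ (fun x => f (remove_ball r X x)) + #|` X|%:R * f X =
  n * f X + \sum_(y <- enum_fset X) f (X `\ y)%fset.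
Proof.
move=> uf hX; have [b1 e1] := integral_on_sum_ball (fun=> f X) hX.1.
have [b2 e2] := integral_on_sum_ball (fun y => f (X `\ y)%fset) hX.1.
have -> : #|` X|%:R * f X = \sum_(y <- enum_fset X) f X.
  by rewrite big_const_seq count_predT iter_addr addr0 mulr_natl.
rewrite -e1 -e2 -integral_onD//; last exact: bounded_measurable_remove.
have -> : n * f X = integ (cst (f X)) by rewrite mulrC; apply/esym; exact: integral_on_cst.
rewrite -integral_onD//; last exact: bounded_measurable_cst.
by congr integral_on; apply/funext => x; exact: remove_ball_sum.
Qed.

(** An insertion has an effect exactly on the free set; the mass that leaves X stands on the left,
    so both sides are sums. *)
Lemma integral_on_insert X (A : set (conf R d)) : measurable A ->
  integ (fun x => \1_A (insert r T X x)) + vol (free r T X) * \1_A X =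
  n * \1_A X + vol [set x | free r T X x /\ A (x |` X)%fset].
Proof.
move=> mA; have uA : unit_fun (\1_A : conf R d -> R).
  split; first exact: measurable_indic.
  by move=> Z; rewrite indicE; case: (_ \in _); rewrite ?lexx ler01.
have mF := measurable_free r X mT.
have mFA : measurable [set x | free r T X x /\ A (x |` X)%fset].
  apply: measurableI => //.
  have mi := measurable_fun_pair2 (f := fun p : conf R d * 'rV[R]_d => (p.2 |` p.1)%fset : conf R d) X
    (@measurable_insert R d).
  exact: (measurable_preimage mi mA).
have bF : bounded_measurable (\1_(free r T X) : _ -> R) by exact: bounded_measurable_indic.
have bI := bounded_measurable_insert r mT X uA.
have -> : vol (free r T X) = integ \1_(free r T X) by rewrite integral_on_indic.
have -> : vol [set x | free r T X x /\ A (x |` X)%fset] =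
  integ \1_[set x | free r T X x /\ A (x |` X)%fset] by rewrite integral_on_indic.
rewrite [X in _ + X = _]mulrC -integral_onZ// -integral_onD//; last exact: bounded_measurableZ.
have -> : n * \1_A X = integ (cst (\1_A X)) by rewrite mulrC; apply/esym; exact: integral_on_cst.
rewrite -integral_onD//; [|exact: bounded_measurable_cst|exact: bounded_measurable_indic].
congr integral_on; apply/funext => x; rewrite /insert /= !indicE.
case: ifPn => [/set_mem xf|/negP xf].
  rewrite mulr1 addrC; congr (_ + (nat_of_bool _)%:R).
  by apply/idP/idP => /set_mem h; apply/mem_set => //; case: h.
rewrite mulr0; congr (_ + _); rewrite memNset// => -[xf' _]; apply: xf.
exact: mem_set.
Qed.

(** * Balance under the Poisson process *)

Hypothesis T_Lam : T `<=` Lam.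
Variable Pi : probability (conf R d) R.
Hypothesis Pi_poisson : is_poisson_process lam T Pi.

Lemma measurable_hard_spheres : measurable hard_spheres.
Proof.
have -> : hard_spheres = [set X | npoints (~` T) X = 0%N] `&` hard_core r.
  apply/seteqP; split=> X [h hX]; split => //.
    by apply/npoints_eq0P; rewrite setCK.
  by move/npoints_eq0P: h; rewrite setCK.
apply: measurableI; last exact: measurable_hard_core.
have /= := measurable_npoints (measurableC mT) measurableT (Y := [set 0%N]) I.
by rewrite setTI.
Qed.

(** The events to which Mecke's formula is applied. On a pair (X minus y, y), [deletions] tests the
    smaller configuration and [insertions] the larger one. *)
Let deletions (A : set (conf R d)) : set (conf R d * 'rV[R]_d) :=
  [set p | free r T p.1 p.2 /\ (hard_spheres p.1 /\ A p.1)].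
Let insertions (A : set (conf R d)) : set (conf R d * 'rV[R]_d) :=
  [set p | free r T p.1 p.2 /\ (hard_spheres p.1 /\ A (p.2 |` p.1)%fset)].

Let measurable_deletions A : measurable A -> measurable (deletions A).
Proof.
move=> mA; apply: measurableI; first exact: measurable_free2.
apply: (measurable_preimage (A := hard_spheres `&` A) measurable_fst).
by apply: measurableI => //; exact: measurable_hard_spheres.
Qed.

Let measurable_insertions A : measurable A -> measurable (insertions A).
Proof.
move=> mA; apply: measurableI; first exact: measurable_free2.
apply: measurableI.
  exact: (measurable_preimage measurable_fst measurable_hard_spheres).
exact: (measurable_preimage (@measurable_insert R d) mA).
Qed.

Let reduced_count_deletions A X : hard_spheres X ->
  (reduced_count (deletions A) X)%:R = \sum_(y <- enum_fset X) \1_A (X `\ y)%fset :> R.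
Proof.
move=> hX; rewrite natr_sum big_seq [RHS]big_seq; apply: eq_bigr => y yX.
rewrite indicE; congr (nat_of_bool _)%:R.
have [hD fD] := (hard_spheres_setD1 yX).1 hX.
by apply/idP/idP => /set_mem h; apply/mem_set => //; case: h => _ [].
Qed.

Let reduced_count_insertions A X : hard_spheres X ->
  (reduced_count (insertions A) X)%:R = #|` X|%:R * \1_A X :> R.
Proof.
move=> hX.
have -> : #|` X|%:R * \1_A X = \sum_(y <- enum_fset X) \1_A X :> R.
  by rewrite big_const_seq count_predT iter_addr addr0 mulr_natl.
rewrite natr_sum big_seq [RHS]big_seq; apply: eq_bigr => y yX.
rewrite indicE; congr (nat_of_bool _)%:R.
have [hD fD] := (hard_spheres_setD1 yX).1 hX.
apply/idP/idP => /set_mem.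
  by rewrite /insertions /= fsetD1K// => -[_ [_ ?]]; exact: mem_set.
by move=> AX; apply/mem_set; rewrite /insertions /= fsetD1K.
Qed.

Let reduced_count_not (G : set (conf R d * 'rV[R]_d)) X : ~ hard_spheres X ->
  (forall p, G p -> free r T p.1 p.2 /\ hard_spheres p.1) -> reduced_count G X = 0%N.
Proof.
move=> hX GP; rewrite /reduced_count big_seq big1// => y yX.
apply/eqP; rewrite eqb0; apply/negP => /set_mem /GP [/= h1 h2].
by apply: hX; apply/(hard_spheres_setD1 yX).
Qed.

Let reduced_count_le (G : set (conf R d * 'rV[R]_d)) X :
  (forall p, G p -> free r T p.1 p.2 /\ hard_spheres p.1) ->
  (reduced_count G X)%:R <= n :> R.
Proof.
move=> GP; case: (pselect (hard_spheres X)) => hX; last first.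
  by rewrite reduced_count_not// volume_in_ge0.
apply: le_trans (card_hard_spheres hX); rewrite ler_nat.
rewrite card_fset_sum1; apply: leq_sum => y _; exact: leq_b1.
Qed.

Let bounded_reduced_count (G : set (conf R d * 'rV[R]_d)) : measurable G ->
  (forall p, G p -> free r T p.1 p.2 /\ hard_spheres p.1) ->
  bounded_measurable (fun X => (reduced_count G X)%:R : R).
Proof.
move=> mG GP; split.
  apply: (@measurableT_comp _ _ _ _ _ _ (fun k : nat => k%:R : measurableTypeR R)) => //.
  exact: measurable_reduced_count.
by exists n => X; rewrite ger0_norm// reduced_count_le.
Qed.

Local Notation E := (integral_on Pi setT).

Let mecke_real (G : set (conf R d * 'rV[R]_d)) : measurable G ->
  (forall p, G p -> free r T p.1 p.2 /\ hard_spheres p.1) ->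
  E (fun X => (reduced_count G X)%:R) = lam * E (fun X => vol (xsection G X)).
Proof.
move=> mG GP; have Pi_lty : (Pi setT < +oo)%E by rewrite probability_setT ltry.
have T_lty : (lebesgue_rV T < +oo)%E.
  by apply: le_lt_trans Lam_lty; apply: le_measure; rewrite ?inE.
apply: EFin_inj; rewrite EFinM -!integral_on_EFin//; last 2 first.
- exact: bounded_measurable_volume.
- exact: bounded_reduced_count.
have := mecke (ltW lam_gt0) mT T_lty Pi_poisson mG; rewrite /campbell => ->.
(* The sections consist of free points, hence lie in [T], so that the volumes relative to [Lam] and
   to [T] agree. *)
congr (_ * _)%E; apply: eq_integral => X _; rewrite -volume_in_fin//; last exact: measurable_xsection.
congr lebesgue_rV; apply/seteqP; split=> x [xG].
  by move=> Tx; split => //; exact: T_Lam.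
by move=> _; split => //; move: xG; rewrite /xsection /= inE => /GP [] [].
Qed.

(** The two preceding one-step identities combine into the pointwise identity [key]. Mecke's formula
    equates the expected reduced count with lam times the expected volume, for insertions and for
    deletions, so these terms cancel between the sides. *)
Lemma transition_balance (A : set (conf R d)) : measurable A -> 0 < n ->
  E (fun X => \1_hard_spheres X * transition r lam Lam T \1_A X) = fine (Pi (A `&` hard_spheres)).
Proof.
move=> mA n0; have Pi_lty : (Pi setT < +oo)%E by rewrite probability_setT ltry.
have mH := measurable_hard_spheres.
have uA : unit_fun (\1_A : conf R d -> R).
  split; first exact: measurable_indic.
  by move=> Z; rewrite indicE; case: (_ \in _); rewrite ?lexx ler01.
have delP p : deletions A p -> free r T p.1 p.2 /\ hard_spheres p.1 by move=> [? []].
have insP p : insertions A p -> free r T p.1 p.2 /\ hard_spheres p.1 by move=> [? []].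
have mdel := measurable_deletions mA; have mins := measurable_insertions mA.
have hd := mecke_real mdel delP; have hi := mecke_real mins insP.
have bd := bounded_reduced_count mdel delP; have bi := bounded_reduced_count mins insP.
have bvd := bounded_measurable_volume mLam Lam_lty mdel.
have bvi := bounded_measurable_volume mLam Lam_lty mins.
have ud := unit_fun_transition r lam_gt0 mLam Lam_lty mT uA.
have be1 : bounded_measurable (fun X => \1_hard_spheres X * transition r lam Lam T \1_A X).
  apply: bounded_measurableM; first exact: bounded_measurable_indic.
  split; first exact: ud.1.
  by exists 1 => X; have /andP[? ?] := ud.2 X; rewrite ger0_norm.
have be4 : bounded_measurable (\1_(A `&` hard_spheres) : _ -> R).
  by apply: bounded_measurable_indic; exact: measurableI.
have nl : 0 < n * (1 + lam) by rewrite mulr_gt0// addr_gt0.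
have key : E (fun X => n * (1 + lam) * (\1_hard_spheres X * transition r lam Lam T \1_A X) +
     ((reduced_count (insertions A) X)%:R + lam * vol (xsection (deletions A) X))) =
  E (fun X => n * (1 + lam) * \1_(A `&` hard_spheres) X +
     ((reduced_count (deletions A) X)%:R + lam * vol (xsection (insertions A) X))).
  congr integral_on; apply/funext => X.
  case: (pselect (hard_spheres X)) => hX; last first.
    rewrite !reduced_count_not// !indicE !memNset//; last by case.
    have vol0 (G : set (conf R d * 'rV[R]_d)) :
        (forall p, G p -> free r T p.1 p.2 /\ hard_spheres p.1) ->
        vol (xsection G X) = 0.
      move=> GP; rewrite (_ : xsection G X = set0) /volume_in ?set0I ?measure0//.
      by apply/seteqP; split=> y //; rewrite /xsection /= inE => /GP [].
    by rewrite !vol0// mul0r !mulr0.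
  rewrite reduced_count_deletions// reduced_count_insertions//.
  have -> : \1_(A `&` hard_spheres) X = \1_A X :> R.
    rewrite !indicE; congr (nat_of_bool _)%:R.
    by apply/idP/idP => /set_mem h; apply/mem_set => //; case: h.
  have -> : vol (xsection (insertions A) X) = vol [set x | free r T X x /\ A (x |` X)%fset].
    congr vol; apply/seteqP; split=> x; rewrite /xsection /= inE; first by case=> ? [].
    by case.
  have -> : vol (xsection (deletions A) X) = vol (free r T X) * \1_A X.
    rewrite indicE; have [/set_mem AX|/negP AX] := boolP (X \in A).
      rewrite mulr1; congr vol; apply/seteqP; split=> x; rewrite /xsection /= inE; first by case.
      by [].
    rewrite mulr0 (_ : xsection _ X = set0) /volume_in ?set0I ?measure0//.
    apply/seteqP; split=> x //; rewrite /xsection /= inE => -[_ [_ AX']].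
    by apply: AX; exact: mem_set.
  have h1 := integral_on_remove_ball uA hX; have h2 := integral_on_insert X mA.
  rewrite indicE mem_set// mul1r /transition mulVKf ?gt_eqF//.
  have h2' := congr1 (fun z => lam * z) h2.
  by move: h1 h2' => /=; lra.
have bk1 := bounded_measurableZ (n * (1 + lam)) be1.
have bk4 := bounded_measurableZ (n * (1 + lam)) be4.
have bl1 := bounded_measurableZ lam bvd; have bl2 := bounded_measurableZ lam bvi.
move: key; rewrite integral_onD//; last exact: bounded_measurableD.
rewrite integral_onZ// integral_onD// [E (fun X => lam * _)]integral_onZ//.
rewrite [RHS]integral_onD//; last exact: bounded_measurableD.
rewrite [E (fun X => _ * \1_(A `&` hard_spheres) X)]integral_onZ//.
rewrite [E (fun X => (reduced_count (deletions A) X)%:R + _)]integral_onD//.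
rewrite [E (fun X => lam * vol (xsection (insertions A) X))]integral_onZ//.
rewrite hd hi [X in _ = _ + X]addrC => /addIr /(mulfI (lt0r_neq0 nl)) ->.
by rewrite integral_on_indic /volume_in ?setIT//; exact: measurableI.
Qed.

End hard_core_configurations.
(** * Evolution of laws and the mixing time *)

Section probability_bundle.
Context (dT : measure_display) (T : measurableType dT) (R : realType).

(** An alias on which a measure of total mass 1 receives the structure of a probability. *)
Definition as_probability (m : {measure set T -> \bar R}) (m1 : m setT = 1%E) :
  set T -> \bar R := m.

Section as_probability.
Variables (m : {measure set T -> \bar R}) (m1 : m setT = 1%E).

HB.instance Definition _ := Measure.on (as_probability m1).
HB.instance Definition _ := Measure_isProbability.Build _ _ _ (as_probability m1) m1.

End as_probability.

(* [law_after] also takes values on nonmeasurable sets, so it agrees with a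
   probability only on measurable sets. *)
Definition raw_probability (P : probability T R) (mu : set T -> \bar R)
  (mu_ge0 : forall A, (0 <= mu A)%E) (muP : forall A, measurable A -> mu A = P A) :
  set T -> \bar R := mu.

Section raw_probability.
Variables (P : probability T R) (mu : set T -> \bar R).
Hypotheses (mu_ge0 : forall A, (0 <= mu A)%E)
  (muP : forall A, measurable A -> mu A = P A).
Let rp := raw_probability mu_ge0 muP.

Let rp0 : rp set0 = 0%E. Proof. by rewrite /rp /raw_probability muP ?measure0. Qed.
Let rp_ge0 A : (0 <= rp A)%E. Proof. exact: mu_ge0. Qed.
Let rp_sigma_additive : semi_sigma_additive rp.
Proof.
move=> F mF tF mUF; rewrite /rp /raw_probability muP//.
rewrite (_ : (fun k => _) = (fun k => \sum_(0 <= i < k) P (F i))%E).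
  exact: measure_semi_sigma_additive.
by apply/funext => k; apply: eq_bigr => i _; rewrite muP.
Qed.

HB.instance Definition _ := isMeasure.Build _ _ _ (raw_probability mu_ge0 muP)
  rp0 rp_ge0 rp_sigma_additive.

Let rpT : raw_probability mu_ge0 muP setT = 1%E.
Proof. by rewrite /raw_probability muP ?probability_setT. Qed.

HB.instance Definition _ := Measure_isProbability.Build _ _ _
  (raw_probability mu_ge0 muP) rpT.

End raw_probability.

End probability_bundle.

Section full_sets.
Context (dT : measure_display) (T : measurableType dT) (R : realType).
Local Open Scope ereal_scope.

Lemma integral_full_set (m : {measure set T -> \bar R}) (H : set T) (f : T -> \bar R) :
  measurable H -> m (~` H) = 0 -> measurable_fun setT f -> (forall x, 0 <= f x) ->
  \int[m]_x f x = \int[m]_(x in H) f x.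
Proof.
move=> mH H0 mf f0.
rewrite (@ge0_negligible_integral _ _ _ m setT (~` H))//; last exact: measurableC.
by rewrite setTD setCK.
Qed.

Lemma integral_mrestr (m : {measure set T -> \bar R}) (H : set T) (mH : measurable H)
    (m1 : {measure set T -> \bar R}) (f : T -> \bar R) :
  m1 = mrestr m mH :> (set T -> \bar R) ->
  measurable_fun setT f -> (forall x, 0 <= f x) ->
  \int[m1]_x f x = \int[m]_(x in H) f x.
Proof.
move=> m1E mf f0; rewrite (integral_full_set mH)//; last first.
  by rewrite m1E /mrestr setICl measure0.
by apply: eq_measure_integral => A mA AH; rewrite m1E /mrestr (setIidl AH).
Qed.

Lemma probability_setC0 (P : probability T R) H : measurable H -> P H = 1 -> P (~` H) = 0.
Proof. by move=> mH H1; rewrite probability_setC// H1 subee. Qed.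

Lemma probability_setI_full (P : probability T R) (H B : set T) :
  measurable H -> measurable B -> P H = 1 -> P (H `&` B) = P B.
Proof.
move=> mH mB H1; rewrite setIC [RHS](measureDI P mB mH).
rewrite [X in _ = X + _](_ : _ = 0) ?add0e//.
apply: (@subset_measure0 _ _ _ P _ (~` H)) => //.
- exact: measurableD.
- exact: measurableC.
- exact: probability_setC0.
Qed.

Lemma expectation_bounds (P : probability T R) (H : set T) (g : T -> R) (a b : R) :
  measurable H -> P H = 1 -> measurable_fun setT g -> (forall x, (0 <= g x <= 1)%R) ->
  (forall x, H x -> (a <= g x <= b)%R) ->
  a%:E <= \int[P]_x (g x)%:E <= b%:E.
Proof.
move=> mH PH mg g01 gab.
have g0 x : 0 <= (g x)%:E by rewrite lee_fin; have /andP[] := g01 x.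
have mg' : measurable_fun setT (EFin \o g) by exact/measurable_EFinP.
have [x0 Hx0] : H !=set0.
  by apply/set0P; apply: contra_eqN PH => /eqP ->; rewrite measure0 eq_sym onee_neq0.
have b0 : (0 <= b)%R.
  have /andP[g0' _] := g01 x0; have /andP[_ gb] := gab _ Hx0.
  exact: le_trans g0' gb.
rewrite (integral_full_set mH (probability_setC0 mH PH))//.
apply/andP; split.
  (* Integrals are compared for nonnegative functions only; a negative a lies below the integral in
     any case. *)
  have [a0|a0] := leP 0%R a; last first.
    apply: (@le_trans _ _ 0); first by rewrite lee_fin ltW.
    by apply: integral_ge0 => x _.
  have -> : a%:E = \int[P]_(x in H) cst a%:E x by rewrite integral_cst// [X in _ * X]PH mule1.
  apply: ge0_le_integral => //; first exact: measurable_funS mg'.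
  by move=> x Hx; rewrite lee_fin; have /andP[] := gab x Hx.
have -> : b%:E = \int[P]_(x in H) cst b%:E x by rewrite integral_cst// [X in _ * X]PH mule1.
apply: ge0_le_integral => //; first exact: measurable_funS mg'.
by move=> x Hx; rewrite lee_fin; have /andP[] := gab x Hx.
Qed.

End full_sets.

(** * Transport of laws by one step *)

Section evolution.
Context {R : realType} {d : nat}.
Variables (r lam : R) (Lam T : set 'rV[R]_d).
Hypotheses (r_gt0 : 0 < r) (lam_gt0 : 0 < lam) (mLam : measurable Lam)
  (Lam_lty : (lebesgue_rV Lam < +oo)%E) (mT : measurable T).
Implicit Types (X : conf R d) (x y v : 'rV[R]_d) (f : conf R d -> R).

Local Notation vol := (volume_in (@lebesgue_rV R d) Lam).
Local Notation integ := (integral_on (@lebesgue_rV R d) Lam).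
Local Notation n := (vol setT).
Local Notation transition := (transition r lam Lam T).
Hypothesis n_gt0 : 0 < n.

Lemma unit_fun_indic (A : set (conf R d)) : measurable A -> unit_fun (\1_A : conf R d -> R).
Proof.
move=> mA; split; first exact: measurable_indic.
by move=> Z; rewrite indicE; case: (_ \in _); rewrite ?lexx ler01.
Qed.

Lemma transition_cst1 : transition (cst 1) = cst 1.
Proof.
apply/funext => X; rewrite /transition.
rewrite (_ : integ (fun x => cst 1 (remove_ball r X x)) = n); last first.
  by rewrite -[RHS]mul1r; exact: integral_on_cst.
rewrite [lam * n]mulrC -{2}[n]mulr1 -mulrDr mulVf// gt_eqF// mulr_gt0//.
by rewrite addr_gt0.
Qed.

(** The new law mixes two pushforwards, under deletion and insertion, of the product of [m] with
    Lebesgue measure on [Lam]. Having it as a measure lets identities on events pass to all of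
    [unit_fun]. *)
Lemma step_measure (m : probability (conf R d) R) :
  exists m' : probability (conf R d) R, forall f, unit_fun f ->
    (\int[m']_X (f X)%:E = \int[m]_X (transition f X)%:E)%E.
Proof.
pose U0 : {measure set 'rV[R]_d -> \bar R} := mrestr (@lebesgue_rV R d) mLam.
have sU0 : sigma_finite setT U0.
  apply: fin_num_fun_sigma_finite; first by rewrite measure0.
  move=> B mB; rewrite ge0_fin_numE//; apply: le_lt_trans Lam_lty.
  by apply: le_measure; rewrite ?inE//; exact: measurableI.
have [U UE] := sigma_finite_bundle sU0.
have mrem := measurable_remove_ball (d := d) r.
have mins := measurable_insert_free r mT.
pose Q : {measure set (conf R d * 'rV[R]_d) -> \bar R} := (m \x U)%E.
pose m1 : {measure set conf R d -> \bar R} := pushforward Q (fun p => remove_ball r p.1 p.2).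
pose m2 : {measure set conf R d -> \bar R} := pushforward Q (fun p => insert r T p.1 p.2).
have nl : 0 < n * (1 + lam) by rewrite mulr_gt0// addr_gt0.
have k0 : 0 <= (n * (1 + lam))^-1 by rewrite invr_ge0 ltW.
pose m3 : {measure set conf R d -> \bar R} := mscale (NngNum k0)
  (measure_add (m1 mrem) (mscale (NngNum (ltW lam_gt0)) (m2 mins))).
have pushE (phi : conf R d * 'rV[R]_d -> conf R d) (mphi : measurable_fun setT phi) f :
    unit_fun f -> (\int[pushforward Q phi]_X (f X)%:E =
    \int[m]_X (integ (fun x => f (phi (X, x))))%:E)%E.
  move=> [mf f01]; have mf' : measurable_fun setT (EFin \o f) by exact/measurable_EFinP.
  rewrite (ge0_integral_pushforward mphi)//=; last first.
    by move=> y _; rewrite lee_fin; have /andP[] := f01 y.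
  rewrite preimage_setT (fubini_tonelli1 (fun p => (f (phi p))%:E))//; last 2 first.
  - by apply: (measurableT_comp mf').
  - by move=> p; rewrite lee_fin; have /andP[] := f01 (phi p).
  apply: eq_integral => X _; rewrite /fubini_F.
  rewrite (integral_mrestr UE)//; last 2 first.
  - apply: (measurableT_comp mf'); exact: (measurable_fun_pair2 X mphi).
  - by move=> x; rewrite lee_fin; have /andP[] := f01 (phi (X, x)).
  apply: integral_on_EFin => //; split.
    by apply: (measurableT_comp mf); exact: (measurable_fun_pair2 X mphi).
  by exists 1 => x; have /andP[? ?] := f01 (phi (X, x)); rewrite ger0_norm.
have m3E f : unit_fun f -> (\int[m3]_X (f X)%:E = \int[m]_X (transition f X)%:E)%E.
  move=> uf; have [mf f01] := uf.
  have mf' : measurable_fun setT (EFin \o f) by exact/measurable_EFinP.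
  have f0 X : setT X -> (0 <= (f X)%:E)%E by rewrite lee_fin; have /andP[] := f01 X.
  rewrite ge0_integral_mscale// ge0_integral_measure_add// ge0_integral_mscale//=.
  rewrite (pushE _ mrem)// (pushE _ mins)//=.
  have int0 (g : conf R d -> 'rV[R]_d -> conf R d) X :
    (0 <= (integ (fun x => f (g X x)))%:E)%E.
    by rewrite lee_fin; apply: Rintegral_ge0 => x _; have /andP[] := f01 (g X x).
  have mi (phi : conf R d * 'rV[R]_d -> conf R d) (mphi : measurable_fun setT phi) :
    measurable_fun setT (fun X => (integ (fun x => f (phi (X, x))))%:E).
    apply/measurable_EFinP; exact: (measurable_integral_on mLam mphi uf).
  have mrem' := mi _ mrem; have mins' := mi _ mins.
  rewrite -ge0_integralZl_EFin//; last by rewrite ltW.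
  rewrite -ge0_integralD//; last 2 first.
  - by move=> X _; rewrite mule_ge0// lee_fin ltW.
  - exact: measurable_funeM.
  rewrite -ge0_integralZl_EFin//; last 2 first.
  - by move=> X _; rewrite adde_ge0// mule_ge0// lee_fin ltW.
  - by apply: emeasurable_funD => //; exact: measurable_funeM.
have m3T : m3 setT = 1%E.
  have u1 : unit_fun (cst 1 : conf R d -> R) by split=> // X /=; rewrite lexx ler01.
  have c1 (P : {measure set conf R d -> \bar R}) : (\int[P]_X (cst 1 X)%:E = P setT)%E.
    by rewrite -[RHS]mul1e; exact: (integral_cst P measurableT 1%:E).
  have := m3E _ u1; rewrite transition_cst1 !c1 => ->; exact: probability_setT.
by exists (as_probability m3T) => f uf; rewrite -m3E.
Qed.

Lemma transition_indic_hard_spheres X : hard_spheres r T X ->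
  transition \1_(hard_spheres r T) X = 1.
Proof.
move=> hX; rewrite -[RHS](congr1 (fun g => g X) transition_cst1) /transition.
congr (_ * (_ + _ * _)); apply: eq_integral_on => x _; rewrite indicE mem_set//=.
  apply: hard_spheres_sub hX; exact: remove_ball_sub.
exact: hard_spheres_insert.
Qed.

Lemma integral_transition_hard_spheres (m : probability (conf R d) R) :
  m (hard_spheres r T) = 1%E ->
  (\int[m]_X (transition \1_(hard_spheres r T) X)%:E = 1)%E.
Proof.
move=> mH1; have mH := measurable_hard_spheres r mT.
have ud := unit_fun_transition r lam_gt0 mLam Lam_lty mT (unit_fun_indic mH).
have := @expectation_bounds _ _ _ m _ (transition \1_(hard_spheres r T)) 1 1 mH mH1 ud.1 ud.2.
move=> /(_ _)/andP[]; first by move=> X hX; rewrite transition_indic_hard_spheres// lexx.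
by move=> h1 h2; apply/eqP; rewrite eq_le h1 h2.
Qed.

End evolution.

(** * The single-center chain started from hard-core configurations *)

Section single_center_evolution.
Context {R : realType} {d : nat}.
Variables (r lam : R) (Lam tau : set 'rV[R]_d).
Local Notation T := (allowed r Lam tau).
Hypotheses (r_gt0 : 0 < r) (lam_gt0 : 0 < lam) (mLam : measurable Lam)
  (Lam_lty : (lebesgue_rV Lam < +oo)%E) (mT : measurable T).
Implicit Types (X : conf R d) (x y v : 'rV[R]_d) (f : conf R d -> R).

Local Notation vol := (volume_in (@lebesgue_rV R d) Lam).
Local Notation integ := (integral_on (@lebesgue_rV R d) Lam).
Local Notation n := (vol setT).
Local Notation transition := (transition r lam Lam T).
Local Notation K := (single_center_kernel r lam Lam tau).
Hypothesis n_gt0 : 0 < n.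

Lemma try_insert_hard_spheres X x : hard_spheres r T X ->
  try_insert r Lam tau X x = insert r T X x.
Proof.
move=> hX; rewrite /try_insert /insert.
have [xX|xX] := boolP (x \in X).
  by rewrite (mem_fset1U xX) !if_same.
congr (if _ then _ else _); apply/idP/idP => /set_mem.
  by move=> /(hard_spheres_setU1 r T xX) [_ h]; exact: mem_set.
by move=> h; apply/mem_set; exact/(hard_spheres_setU1 r T xX).
Qed.

Let removed X (A : set (conf R d)) : set 'rV[R]_d := [set x | A (remove_ball r X x)].
Let tried X (A : set (conf R d)) : set 'rV[R]_d := [set x | A (try_insert r Lam tau X x)].

Lemma measurable_try_insert : measurable_fun setT
  (fun p : conf R d * 'rV[R]_d => try_insert r Lam tau p.1 p.2).
Proof.
apply: measurable_fun_ifT; [|exact: measurable_insert|exact: measurable_fst].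
apply: (@measurable_fun_bool _ _ _ _ true).
rewrite setTI (_ : _ @^-1` _ = (fun p : conf R d * 'rV[R]_d => (p.2 |` p.1)%fset : conf R d)
    @^-1` Omega r Lam tau).
  exact: (measurable_preimage (@measurable_insert R d) (measurable_Omega mT)).
by apply/seteqP; split=> p; [exact: set_mem|exact: mem_set].
Qed.

Lemma kernel_vol X (A : set (conf R d)) : K X A =
  ((n * (1 + lam))^-1 * (vol (removed X A) + lam * vol (tried X A)))%:E.
Proof.
rewrite /single_center_kernel /uniform_on -/(removed X A) -/(tried X A).
have -> : fine (lebesgue_rV Lam) = n by rewrite /volume_in setTI.
rewrite -/(vol (removed X A)) -/(vol (tried X A)); congr EFin.
by rewrite invfM; lra.
Qed.

Lemma kernel_transition X (A : set (conf R d)) : measurable A -> hard_spheres r T X ->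
  K X A = (transition \1_A X)%:E.
Proof.
move=> mA hX; rewrite kernel_vol /transition; congr (_ * (_ + _ * _))%:E.
  rewrite -[LHS](integral_on_indic (@lebesgue_rV R d) mLam)//.
  exact: (measurable_preimage (measurable_fun_pair2 X (measurable_remove_ball r)) mA).
rewrite -[LHS](integral_on_indic (@lebesgue_rV R d) mLam).
  by apply: eq_integral_on => x _; rewrite -try_insert_hard_spheres.
exact: (measurable_preimage (measurable_fun_pair2 X measurable_try_insert) mA).
Qed.

Lemma kernel_ge0 X (A : set (conf R d)) : (0 <= K X A)%E.
Proof.
rewrite kernel_vol lee_fin mulr_ge0//.
  by rewrite invr_ge0 mulr_ge0// ?volume_in_ge0// addr_ge0// ltW.
by rewrite addr_ge0 ?mulr_ge0 ?volume_in_ge0// ltW.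
Qed.

Lemma measurable_kernel (A : set (conf R d)) : measurable A ->
  measurable_fun setT (fun X => K X A).
Proof.
move=> mA; under eq_fun do rewrite kernel_vol.
apply/measurable_EFinP; apply: measurable_funM => //; apply: measurable_funD.
  have := (bounded_measurable_volume mLam Lam_lty
    (measurable_preimage (measurable_remove_ball r) mA)).1.
  congr measurable_fun; apply/funext => X; congr vol.
  by apply/seteqP; split=> x; rewrite /xsection /= inE.
apply: measurable_funM => //.
have := (bounded_measurable_volume mLam Lam_lty
  (measurable_preimage measurable_try_insert mA)).1.
congr measurable_fun; apply/funext => X; congr vol.
by apply/seteqP; split=> x; rewrite /xsection /= inE.
Qed.

(** The kernel is identified with [transition] on hard-core configurations, so the induction also
    carries that the law gives them mass 1. *)
Lemma law_after_transition (p : probability (conf R d) R) (t : nat) :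
  p (Omega r Lam tau) = 1%E ->
  exists m : probability (conf R d) R,
    [/\ m = law_after K p t :> (set _ -> \bar R), m (hard_spheres r T) = 1%E &
      forall f, unit_fun f -> (\int[m]_X (f X)%:E = \int[p]_X (iter t transition f X)%:E)%E].
Proof.
move=> pO; elim: t => [|t [m [mE mH IH]]]; first by exists p.
have mhs := measurable_hard_spheres r mT.
have [m' m'E] := step_measure r lam_gt0 mLam Lam_lty mT n_gt0 m.
have m'P A : measurable A -> law_after K p t.+1 A = m' A.
  move=> mA; rewrite /= -mE.
  have uA := unit_fun_indic mA; have ud := unit_fun_transition r lam_gt0 mLam Lam_lty mT uA.
  have mH0 := probability_setC0 mhs mH.
  rewrite (integral_full_set mhs mH0)//; last 2 first.
  - exact: measurable_kernel.
  - by move=> X; exact: kernel_ge0.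
  transitivity (\int[m]_(X in hard_spheres r T) (transition \1_A X)%:E)%E.
    by apply: eq_integral => X /set_mem hX; exact: kernel_transition.
  rewrite -(integral_full_set mhs mH0)//; last 2 first.
  - by apply/measurable_EFinP; exact: ud.1.
  - by move=> X; rewrite lee_fin; have /andP[] := ud.2 X.
  by rewrite -m'E// integral_indic// setIT.
have law0 A : (0 <= law_after K p t.+1 A)%E.
  by rewrite /= -mE; apply: integral_ge0 => X _; exact: kernel_ge0.
exists (raw_probability law0 m'P); split => //.
  rewrite [LHS]m'P//.
  have uH := unit_fun_indic mhs.
  transitivity (\int[m']_X (\1_(hard_spheres r T) X)%:E)%E.
    by rewrite integral_indic// setIT.
  by rewrite m'E// integral_transition_hard_spheres.
move=> f uf; rewrite (@eq_measure_integral _ _ _ _ m'); last first.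
  by move=> A mA _; exact: m'P.
by rewrite m'E// IH ?iterSr//; exact: unit_fun_transition.
Qed.

(** Stationarity on events says that [mu] and its image under one step agree on measurable sets,
    hence have the same integrals. *)
Lemma stationary_iter (mu : probability (conf R d) R) t f :
  (forall A, measurable A -> (\int[mu]_X (transition \1_A X)%:E = mu A)%E) ->
  unit_fun f -> (\int[mu]_X (iter t transition f X)%:E = \int[mu]_X (f X)%:E)%E.
Proof.
move=> st; have [mu' mu'E] := step_measure r lam_gt0 mLam Lam_lty mT n_gt0 mu.
have uit t' g : unit_fun g -> unit_fun (iter t' transition g).
  by move=> ug; elim: t' => //= t' IH; exact: unit_fun_transition.
have st1 g : unit_fun g -> (\int[mu]_X (transition g X)%:E = \int[mu]_X (g X)%:E)%E.
  move=> ug; rewrite -mu'E//; apply: eq_measure_integral => A mA _.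
  transitivity (\int[mu]_X (transition \1_A X)%:E)%E; last exact: st.
  by rewrite -mu'E; [rewrite integral_indic// setIT|exact: unit_fun_indic].
by move=> uf; elim: t => //= t IH; rewrite st1//; exact: uit.
Qed.

End single_center_evolution.

(** * Total variation bound after t steps *)

Section mixing_bound.
Context {R : realType} {d : nat}.
Variables (r lam gam c M : R) (Lam tau : set 'rV[R]_d).
Local Notation T := (allowed r Lam tau).
Hypotheses (r_gt0 : 0 < r) (lam_gt0 : 0 < lam) (mLam : measurable Lam)
  (Lam_lty : (lebesgue_rV Lam < +oo)%E) (mT : measurable T).
Local Notation vol := (volume_in (@lebesgue_rV R d) Lam).
Local Notation n := (vol setT).
Local Notation transition := (transition r lam Lam T).
Local Notation K := (single_center_kernel r lam Lam tau).
Hypotheses (c_ge0 : 0 <= c) (gam_ge0 : 0 <= gam) (gam_le1 : gam <= 1)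
  (cM : c * M = 1 - gam) (lamE : lam = 2 * c) (lam_le1 : lam <= 1).
Hypothesis n_ge1 : 1 <= n.
Hypothesis vol_ball : forall v, T v -> vol (eball v r) = 1.
Hypothesis vol_ball2 : forall v, vol (eball v (2 * r)) <= M.
Implicit Types (X : conf R d) (f : conf R d -> R).

Let n_gt0 : 0 < n. Proof. exact: lt_le_trans n_ge1. Qed.

Let q := 1 - gam / (4 * n).

Let q_ge0 : 0 <= q.
Proof.
rewrite subr_ge0 ler_pdivrMr ?mul1r ?mulr_gt0//.
apply: le_trans gam_le1 _; have := n_ge1; lra.
Qed.

Lemma unit_fun_iter t f : unit_fun f -> unit_fun (iter t transition f).
Proof. by move=> uf; elim: t => //= t IH; exact: unit_fun_transition. Qed.

Lemma lipschitz_iter t f : unit_fun f -> lipschitz r Lam T c 1 f ->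
  lipschitz r Lam T c (q ^+ t) (iter t transition f).
Proof.
move=> uf fL; elim: t => [|t IH]; first by rewrite expr0.
rewrite exprSr; apply: (lipschitz_transition r_gt0 lam_gt0 mLam Lam_lty mT c_ge0
  gam_ge0 cM lamE lam_le1 n_gt0 vol_ball vol_ball2) => //; first exact: exprn_ge0.
exact: unit_fun_iter.
Qed.

Lemma lipschitz1_unit_fun f : unit_fun f -> lipschitz r Lam T c 1 f.
Proof.
move=> [_ f01] X v _ _ _; rewrite mul1r; apply: (@le_trans _ _ 1); last exact: weight_ge1.
have /andP[a0 a1] := f01 (v |` X)%fset; have /andP[b0 b1] := f01 X.
by rewrite ler_norml; apply/andP; split; lra.
Qed.

(** X is built from the empty configuration one center at a time, and each addition costs at most 2
    L because weights are at most 2. *)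
Lemma lipschitz_card L f X : 0 <= L -> lipschitz r Lam T c L f -> [set` X] `<=` T ->
  `|f X - f fset0| <= 2 * L * #|` X|%:R.
Proof.
move=> L0 fL; elim/fset1U_rect: X => [|v X vX IH] XT.
  by rewrite subrr normr0 cardfs0 mulr0.
have XT' : [set` X] `<=` T by move=> y /= yX; apply: XT; rewrite /= !inE yX orbT.
have Tv : T v by apply: XT; rewrite /= !inE eqxx.
have h1 := IH XT'; have h2 := fL _ _ XT' Tv vX.
rewrite cardfsU1 vX natrD mulrDr mulr1.
have -> : f (v |` X)%fset - f fset0 = (f (v |` X)%fset - f X) + (f X - f fset0) by lra.
apply: le_trans (ler_normD _ _) _; rewrite lerD//.
apply: le_trans h2 _; rewrite [2 * L]mulrC ler_wpM2l//.
exact: (weight_le2 mLam Lam_lty mT c_ge0 gam_ge0 cM vol_ball2).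
Qed.

(** Both probabilities of [A] are averages of the t-fold iterate of its indicator. On [Omega] this
    function stays within 2 n q^t of its value at the empty configuration, so the averages differ by
    at most twice that. *)
Lemma law_after_tv (p mu : probability (conf R d) R) t :
  p (Omega r Lam tau) = 1%E -> mu (Omega r Lam tau) = 1%E ->
  (forall A, measurable A -> (\int[mu]_X (transition \1_A X)%:E = mu A)%E) ->
  (tv_dist (law_after K p t) mu <= (4 * n * q ^+ t)%:E)%E.
Proof.
move=> pO muO st; apply: ge_ereal_sup => _ [A mA <-].
have [m [mE mH mI]] := law_after_transition r_gt0 lam_gt0 mLam Lam_lty mT n_gt0 t pO.
have uA := @unit_fun_indic R d A mA.
pose g := iter t transition (\1_A : conf R d -> R).
have ug : unit_fun g by exact: unit_fun_iter.
have mhs := measurable_Omega mT.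
have -> : law_after K p t A = (\int[p]_X (g X)%:E)%E.
  by rewrite -mE -mI// integral_indic// setIT.
have -> : mu A = (\int[mu]_X (g X)%:E)%E.
  rewrite (stationary_iter lam_gt0 mLam Lam_lty mT n_gt0)//.
  by rewrite integral_indic// setIT.
have gb X : Omega r Lam tau X ->
    g fset0 - 2 * n * q ^+ t <= g X <= g fset0 + 2 * n * q ^+ t.
  move=> hX; have /(lipschitz_iter t uA) gL := lipschitz1_unit_fun uA.
  have qt : 0 <= q ^+ t by exact: exprn_ge0.
  have := lipschitz_card qt gL hX.1; rewrite ler_distl.
  have : 2 * q ^+ t * #|` X|%:R <= 2 * n * q ^+ t.
    rewrite -[leRHS]mulrA [n * _]mulrC mulrA ler_wpM2l ?mulr_ge0//.
    exact: (card_hard_spheres mLam Lam_lty vol_ball hX).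
  by move=> h1 /andP[h2 h3]; apply/andP; split; move: h1 h2 h3; rewrite -/g; lra.
have /andP[p1 p2] := expectation_bounds mhs pO ug.1 ug.2 gb.
have /andP[m1 m2] := expectation_bounds mhs muO ug.1 ug.2 gb.
have pf : (\int[p]_X (g X)%:E)%E \is a fin_num.
  by rewrite fin_numE; apply/andP; split; apply/eqP => h; move: p1 p2; rewrite h.
have mf : (\int[mu]_X (g X)%:E)%E \is a fin_num.
  by rewrite fin_numE; apply/andP; split; apply/eqP => h; move: m1 m2; rewrite h.
move: (\int[p]_X _)%E (\int[mu]_X _)%E pf mf p1 p2 m1 m2 => [a| |] [b| |] //= _ _.
rewrite !lee_fin -!mulrA; move: (n * q ^+ t) (g fset0) => z w p1 p2 m1 m2.
by rewrite ler_norml; apply/andP; split; lra.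
Qed.

End mixing_bound.

(** * From the Poisson process to the hard sphere measure *)

Section stationarity.
Context {R : realType} {d : nat}.
Variables (r lam : R) (Lam tau : set 'rV[R]_d).
Local Notation T := (allowed r Lam tau).
Hypotheses (r_gt0 : 0 < r) (lam_gt0 : 0 < lam) (mLam : measurable Lam)
  (Lam_lty : (lebesgue_rV Lam < +oo)%E) (mT : measurable T).
Local Notation vol := (volume_in (@lebesgue_rV R d) Lam).
Local Notation n := (vol setT).
Local Notation transition := (transition r lam Lam T).
Hypothesis vol_ball : forall v, T v -> vol (eball v r) = 1.
Hypothesis T_Lam : T `<=` Lam.
Variable mu : probability (conf R d) R.
Hypothesis muP : is_hard_sphere_measure r lam Lam tau mu.

(** The Poisson process almost surely has no point outside [T], so conditioning on [hard_core] is
    the same as conditioning on [Omega]. *)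
Lemma hard_sphere_measure_Omega :
  exists2 Pi : probability (conf R d) R, is_poisson_process lam T Pi &
  exists2 Z : R, 0 < Z &
  forall A, measurable A -> mu A = (Z * fine (Pi (A `&` Omega r Lam tau)))%:E.
Proof.
have [Pi PiP muE] := muP; exists Pi => //.
have mhc := @measurable_hard_core R d r.
have out0 : Pi [set X | npoints (~` T) X = 0%N] = 1%E.
  rewrite (PiP.1 _ 0%N (measurableC mT))/= setICl measure0 mulr0 oppr0 expR0.
  by rewrite expr0 fact0 mulr1 divr1.
have mout : measurable [set X : conf R d | npoints (~` T) X = 0%N].
  have := measurable_npoints (measurableC mT) measurableT (Y := [set 0%N]) I.
  by rewrite setTI.
have PiO A : measurable A -> Pi (A `&` Omega r Lam tau) = Pi (A `&` hard_core r).
  move=> mA; rewrite Omega_npoints setIC -setIA [hard_core _ `&` _]setIC.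
  have mAh : measurable (A `&` hard_core r) by exact: measurableI.
  exact: probability_setI_full.
(* If this probability were 0, division by zero would make [mu] vanish, although [mu] has total mass
   1. *)
have Z0 : 0 < fine (Pi (hard_core r)).
  rewrite lt_neqAle fine_ge0// andbT eq_sym; apply/negP => /eqP Z0.
  have := muE setT measurableT; rewrite Z0 invr0 mulr0 => mu0.
  have : mu setT = 1%E by exact: probability_setT.
  by rewrite mu0 => /eqP; rewrite eqe eq_sym oner_eq0.
exists (fine (Pi (hard_core r)))^-1; first by rewrite invr_gt0.
by move=> A mA; rewrite muE// PiO// mulrC.
Qed.

Lemma hard_sphere_measure_support : mu (Omega r Lam tau) = 1%E.
Proof.
have [Pi PiP [Z Z0 muE]] := hard_sphere_measure_Omega.
have : mu setT = 1%E by exact: probability_setT.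
by rewrite muE// setTI muE// ?setIid//; exact: measurable_Omega.
Qed.

Lemma hard_sphere_measure_stationary A : 0 < n -> measurable A ->
  (\int[mu]_X (transition \1_A X)%:E = mu A)%E.
Proof.
move=> n0 mA; have [Pi PiP [Z Z0 muE]] := hard_sphere_measure_Omega.
have mO := measurable_Omega mT; have mu1 := hard_sphere_measure_support.
have uA := @unit_fun_indic R d A mA.
have ud := unit_fun_transition r lam_gt0 mLam Lam_lty mT uA.
have md : measurable_fun setT (EFin \o transition \1_A) by apply/measurable_EFinP; exact: ud.1.
have d0 X : (0 <= (transition \1_A X)%:E)%E by rewrite lee_fin; have /andP[] := ud.2 X.
have Pi_lty : (Pi setT < +oo)%E by rewrite probability_setT ltry.
rewrite (integral_full_set mO (probability_setC0 mO mu1))//.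
have -> : (\int[mu]_(X in Omega r Lam tau) (transition \1_A X)%:E =
    \int[mscale (NngNum (ltW Z0)) Pi]_(X in Omega r Lam tau) (transition \1_A X)%:E)%E.
  apply: eq_measure_integral => B mB BO.
  by have := muE B mB; rewrite (setIidl BO) EFinM fineK// fin_num_measure.
rewrite ge0_integral_mscale//; last exact: measurable_funS md.
have -> : (\int[Pi]_(X in Omega r Lam tau) (transition \1_A X)%:E =
    \int[Pi]_X (\1_(Omega r Lam tau) X * transition \1_A X)%:E)%E.
  rewrite [LHS]integral_mkcond; apply: eq_integral => X _.
  by rewrite patchE indicE; case: ifPn => _; rewrite ?mul1r ?mul0r.
rewrite integral_on_EFin//; last first.
  apply: bounded_measurableM; first exact: bounded_measurable_indic.
  split; first exact: ud.1.
  by exists 1 => X; have /andP[? ?] := ud.2 X; rewrite ger0_norm.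
rewrite [integral_on _ _ _](transition_balance lam_gt0 mLam Lam_lty mT vol_ball T_Lam PiP mA n0).
by rewrite muE.
Qed.

End stationarity.

(** * The mixing time bound *)

Lemma mixing_time_le {dT : measure_display} {T : measurableType dT} {R : realType}
    (K : T -> set T -> \bar R) (S : set T) (mu : probability T R) (eps : R) (t : nat) :
  (forall p : probability T R, p S = 1%E ->
    tv_dist (law_after K p t) mu <= eps%:E)%E ->
  (mixing_time K S mu eps <= t%:R%:E)%E.
Proof.
move=> h; apply: ge_ereal_sup => _ [p pS <-]; apply: ereal_inf_lbound.
by exists t => //; exact: h.
Qed.

Lemma probability_singleton_support {dT : measure_display} {T : measurableType dT}
    {R : realType} (P : probability T R) (S A : set T) (x : T) :
  measurable S -> measurable A -> P S = 1%E -> S `<=` [set x] ->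
  P A = (\1_A x)%:E.
Proof.
move=> mS mA PS Sx; rewrite -(probability_setI_full mS mA PS) indicE.
have [/set_mem Ax|/negP Ax] := boolP (x \in A).
  rewrite (_ : S `&` A = S)//; apply/setIidl => y /Sx ->; exact: Ax.
rewrite (_ : S `&` A = set0) ?measure0//; apply/seteqP; split=> // y [/Sx ->] Ax'.
by apply: Ax; exact: mem_set.
Qed.

(** From 1 - x <= exp(- x) the power is at most eps / (2^(d+2) n), and multiplying by 4 n leaves eps
    / 2^d. *)
Lemma contraction_time {R : realType} (n gam eps : R) (d t : nat) :
  1 <= n -> 0 < gam -> gam < 1 -> 0 < eps -> (0 < d)%N ->
  4 * n * (ln (2 ^+ (d + 2) * n) + ln eps^-1) / gam <= t%:R ->
  4 * n * (1 - gam / (4 * n)) ^+ t <= eps.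
Proof.
move=> n1 gam0 gam1 eps0 d0 ht.
have n0 : 0 < n by exact: lt_le_trans n1.
have n4 : 0 < 4 * n by rewrite mulr_gt0.
set x := gam / (4 * n).
have x0 : 0 < x by rewrite divr_gt0.
have x1 : 0 <= 1 - x.
  by rewrite subr_ge0 ler_pdivrMr// mul1r; lra.
have a0 : 0 < 2 ^+ (d + 2) * n by rewrite mulr_gt0// exprn_gt0.
have h1 : (1 - x) ^+ t <= expR (- x * t%:R).
  rewrite expRM_natr lerXn2r ?nnegrE ?expR_ge0//.
  by have := expR_ge1Dx (- x).
have h2 : - x * t%:R <= - (ln (2 ^+ (d + 2) * n) + ln eps^-1).
  rewrite mulNr lerN2 /x mulrAC ler_pdivlMr//.
  by move: ht; rewrite ler_pdivrMr//; lra.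
have h3 : (1 - x) ^+ t <= eps / (2 ^+ (d + 2) * n).
  apply: le_trans h1 _; apply: (@le_trans _ _ (expR (- (ln (2 ^+ (d + 2) * n) + ln eps^-1)))).
    by rewrite ler_expR.
  rewrite opprD expRD !expRN !lnK ?posrE ?invr_gt0// invrK mulrC.
  exact: lexx.
apply: (@le_trans _ _ (4 * n * (eps / (2 ^+ (d + 2) * n)))).
  by rewrite ler_pM2l.
rewrite mulrA ler_pdivrMr// mulrC ler_pM2l// ler_pM2r// addnC exprD.
have : 1 <= 2 ^+ d :> R by rewrite exprn_ege1// ler1n.
by rewrite (_ : 2 ^+ 2 = 4 :> R) ?expr2; lra.
Qed.

Theorem theorem3p2 (R : realType) (d : nat) (d_gt0 : (0 < d)%N)
  (r : R) (r_gt0 : 0 < r)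
  (r_vol : lebesgue_rV (eball (0 : 'rV[R]_d) r) = 1%E)
  (Lam : set 'rV[R]_d) (Lam_compact : compact Lam) (Lam_meas : measurable Lam)
  (gam : R) (gam_gt0 : 0 < gam) (gam_lt1 : gam < 1)
  (tau : set 'rV[R]_d) (tau_meas : measurable tau)
  (tau_sub : tau `<=` interior_at r Lam)
  (mu : probability (conf R d) R) (eps : R) (eps_gt0 : 0 < eps) :
  let n : R := fine (lebesgue_rV Lam) in
  let lam : R := (1 - gam) * 2 ^ (1 - d%:Z) in
  is_hard_sphere_measure r lam Lam tau mu ->
  (mixing_time (single_center_kernel r lam Lam tau) (Omega r Lam tau) mu eps <=
   (Num.max 0 (Num.ceil
      (4 * n * (ln (2 ^+ (d + 2) * n) + ln eps^-1) / gam)))%:~R%:E)%E.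
Proof.
move=> n lam muP.
pose T := allowed r Lam tau.
have Lam_closed : closed Lam by apply: compact_closed => //; exact: norm_hausdorff.
have mT : measurable T.
  by apply: measurableD => //; exact: measurable_interior_at.
have mO : measurable (Omega r Lam tau) by exact: measurable_Omega.
have Lam_lty : (lebesgue_rV Lam < +oo)%E.
  by apply: (compact_lebesgue_lty r_gt0) => //; rewrite r_vol ltry.
have T_Lam : T `<=` Lam by move=> x [[]].
have T_ball v : T v -> eball v r `<=` Lam by move=> [/interior_at_eball].
have nE : volume_in (@lebesgue_rV R d) Lam setT = n by rewrite /volume_in setTI.
have vol_ball v : T v -> volume_in (@lebesgue_rV R d) Lam (eball v r) = 1.
  move=> /T_ball vL; rewrite /volume_in (setIidl vL).
  suff /(congr1 fine) : lebesgue_rV (eball v r) = 1%E by [].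
  by have := lebesgue_eballM r v ltr01; rewrite mul1r expr1n mul1e r_vol.
have vol_ball2 v : volume_in (@lebesgue_rV R d) Lam (eball v (2 * r)) <= 2 ^+ d.
  rewrite -lee_fin -volume_in_fin//; last exact: measurable_eball.
  apply: (@le_trans _ _ (lebesgue_rV (eball v (2 * r)))).
    by apply: le_measure; rewrite ?inE//; [apply: measurableI => //|];
      exact: measurable_eball.
  by rewrite lebesgue_eballM// r_vol mule1.
set B := 4 * n * _ / gam.
(* The bound can be negative, for instance for large eps; the maximum with 0 makes it a number of
   steps. *)
pose z : int := Num.max 0 (Num.ceil B).
pose t := `|z|%N.
have tE : t%:R = z%:~R :> R.
  by rewrite /t natr_absz ger0_norm// /z le_max lexx.
have Bt : B <= t%:R.
  by rewrite tE (le_trans (ceil_ge B))// ler_int le_max lexx orbT.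
have mu1 : mu (Omega r Lam tau) = 1%E := hard_sphere_measure_support mT muP.
(* For n < 1 no ball of volume 1 fits, so the empty configuration is the only state and every
   initial law equals [mu] at time 0. *)
have [n1|n1] := ltP n 1.
  apply: (@le_trans _ _ 0%:R%:E); last by rewrite -/z -tE lee_fin ler_nat.
  apply: mixing_time_le => p pO; apply: ge_ereal_sup => _ [A mA <-] /=.
  have Omega0 : Omega r Lam tau `<=` [set fset0].
    move=> X [XT _]; apply/eqP; rewrite /= -[_ == _]negbK; apply/negP => /fset0Pn[v vX].
    have := volume_in_le Lam_meas Lam_lty (measurable_eball v r).
    by rewrite vol_ball ?nE; [rewrite leNgt n1|exact: XT].
  rewrite (probability_singleton_support mO mA pO Omega0).
  rewrite (probability_singleton_support mO mA mu1 Omega0).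
  by rewrite -EFinB subrr abse0 lee_fin ltW.
rewrite -/z -tE; apply: mixing_time_le => p pO.
have two0 : (2 : R) != 0 by rewrite pnatr_eq0.
have pow0 : 0 < 2 ^+ d :> R by rewrite exprn_gt0.
(* Half of lam, so that c M = 1 - gam for M = 2^d, the volume of a ball of radius 2r. *)
pose c : R := (1 - gam) / 2 ^+ d.
have lamE : lam = 2 * c.
  by rewrite /lam /c expfzDr// expr1z -exprnN; lra.
have c0 : 0 < c by rewrite divr_gt0// subr_gt0.
have lam0 : 0 < lam by rewrite lamE mulr_gt0.
have cM : c * 2 ^+ d = 1 - gam by rewrite /c mulfVK// gt_eqF.
have lam1 : lam <= 1.
  rewrite lamE /c mulrA ler_pdivrMr// mul1r.
  have : 2 <= 2 ^+ d :> R by rewrite -{1}[2]expr1 ler_eXn2l// ltr1n.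
  by move: gam_gt0 => /=; lra.
have := law_after_tv r_gt0 lam0 Lam_meas Lam_lty mT (ltW c0) (ltW gam_gt0) (ltW gam_lt1)
  cM lamE lam1 _ vol_ball vol_ball2 t pO mu1.
rewrite nE => /(_ n1) h; apply: le_trans (h _) _.
  move=> A mA; apply: hard_sphere_measure_stationary => //.
  by rewrite nE (lt_le_trans _ n1).
by rewrite lee_fin; exact: contraction_time Bt.
Qed.
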